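(* Let $p\ge 1$ and let $x_0\sim\mathcal N(0,\Sigma_0)$ and $x_1\sim\mathcal N(0,\Sigma_1)$ be independent centered Gaussian vectors in $\mathbb R^p$ with covariance matrices $\Sigma_0,\Sigma_1\succ 0$. Let $y\sim\mathcal N(0,I)$ be a standard normal vector in $\mathbb R^p$ and let $s$ be uniformly distributed on $(0,1)$, independent of $y$. Then for every $t>0$ $$\mathbb P(x_1\in\mathcal B_t)-\mathbb P(x_0\in\mathcal B_t)=\mathbb L_{y,s}\left(\mathbf 1\left(y^T\Sigma_s y<t\right)\right),$$ i.e. the left-hand side equals $\frac12\,\mathbb E\left[\left(y^T(\log'\Sigma_s)\,y-\log'\det\Sigma_s\right)\mathbf 1\left(y^T\Sigma_s y<t\right)\right]$.
   Context: For $t>0$, $\mathcal B_t=\{x\in\mathbb R^p:\|x\|<\sqrt t\}$ with $\|\cdot\|$ the Euclidean norm. For $s\in[0,1]$, $\Sigma_s=(1-s)\Sigma_0+s\Sigma_1$; $\log'\Sigma_s$ denotes the matrix $(\Sigma_1-\Sigma_0)\Sigma_s^{-1}$, and $\log'\det\Sigma_s=\frac{d}{ds}\log\det\Sigma_s=\mathrm{Tr}\left((\Sigma_1-\Sigma_0)\Sigma_s^{-1}\right)$. The linear operator $\mathbb L_{y,s}$ acts on functions $h(y,s)$ by $$\mathbb L_{y,s}(h)=\frac12\,\mathbb E\left[\left(y^T(\log'\Sigma_s)\,y-\log'\det\Sigma_s\right)h(y,s)\right],$$ the expectation being over both $y$ and $s$. *)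

(* Defs.v *)
(* MathComp-Analysis. A vector of R^p is a [p.-tuple R], the type on which the
   library puts the product sigma-algebra (it puts none on ['cV[R]_p]); [tcol]
   moves to column matrices for the linear algebra. *)
From HB Require Import structures.
From mathcomp Require Import all_boot all_order all_algebra.
From mathcomp Require Import all_classical all_reals all_analysis.
Set Implicit Arguments.
Unset Strict Implicit.
Unset Printing Implicit Defensive.
Import Order.TTheory GRing.Theory Num.Theory.
Import numFieldNormedType.Exports.
Local Open Scope classical_set_scope.
Local Open Scope ring_scope.

Section linear_algebra.
Context {R : realType} {p : nat}.
Implicit Types (S A : 'M[R]_p) (x : p.-tuple R).

Definition posdefmx S :=
  S^T = S /\ forall v : 'cV[R]_p, v != 0 -> 0 < (v^T *m S *m v) 0 0.

Definition tcol x : 'cV[R]_p := \col_i tnth x i.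

Definition qform A x : R := ((tcol x)^T *m A *m tcol x) 0 0.

(* The norm [`|_|] that MathComp-Analysis puts on matrices is the sup norm, so
   the Euclidean norm is spelled out. *)
Definition enorm x : R := Num.sqrt (\sum_(i < p) tnth x i ^+ 2).

Definition eball (t : R) : set (p.-tuple R) := [set x | enorm x < Num.sqrt t].

Definition Sigma (S0 S1 : 'M[R]_p) (s : R) : 'M[R]_p :=
  (1 - s) *: S0 + s *: S1.

(* The matrix written log' Sigma_s; it need not be symmetric. *)
Definition dlogSigma (S0 S1 : 'M[R]_p) (s : R) : 'M[R]_p :=
  (S1 - S0) *m invmx (Sigma S0 S1 s).

Definition dlogdetSigma (S0 S1 : 'M[R]_p) (s : R) : R :=
  derive1 (fun u => ln (\det (Sigma S0 S1 u))) s.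

End linear_algebra.

Section lebesgue_measure_tuple.
Context {R : realType}.

Definition consT n (z : R * n.-tuple R) : n.+1.-tuple R :=
  [tuple of z.1 :: z.2].

Lemma measurable_consT n : measurable_fun [set: R * n.-tuple R] (@consT n).
Proof. exact: measurable_cons. Qed.

(* Lebesgue measure on R^n: on R^0 it is the unit mass at the only point, on
   R^(n+1) it is the image under [consT] of the product measure on R * R^n. *)
Fixpoint lebesgue_tuple n : set (n.-tuple R) -> \bar R :=
  if n is m.+1 then
    pushforward (@lebesgue_measure R \x @lebesgue_tuple m)%E (@consT m)
  else \d_[tuple].

Section step.
Variables (n : nat) (mu : {sigma_finite_measure set (n.-tuple R) -> \bar R}).

Definition lebesgue_step : set (n.+1.-tuple R) -> \bar R :=
  pushforward (@lebesgue_measure R \x mu)%E (@consT n).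

Local Notation nu := lebesgue_step.

Let nu0 : nu set0 = 0%E.
Proof. by rewrite /lebesgue_step /pushforward preimage_set0 measure0. Qed.

Let nu_ge0 A : (0 <= nu A)%E.
Proof. by rewrite /lebesgue_step /pushforward; exact: integral_ge0. Qed.

Let nu_sigma_additive : semi_sigma_additive nu.
Proof. apply: measure_semi_sigma_additive; exact: measurable_consT. Qed.

HB.instance Definition _ := isMeasure.Build _ _ _ nu
  nu0 nu_ge0 nu_sigma_additive.

Let nu_sigma_finite : sigma_finite setT nu.
Proof.
have /sigma_finiteP[F [TF ndF Foo]] := sigma_finiteT (@lebesgue_measure R).
have /sigma_finiteP[G [TG ndG Goo]] := sigma_finiteT mu.
pose uncons (x : n.+1.-tuple R) : R * n.-tuple R :=
  (thead x, [tuple of behead x]).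
have consTK : cancel (@consT n) uncons.
  by case=> a x; congr pair; exact: val_inj.
exists (fun k => uncons @^-1` (F k `*` G k)).
  apply/esym; rewrite -subTset => x _.
  have [i _ Fi] : (\bigcup_i F i) (uncons x).1 by rewrite -TF.
  have [j _ Gj] : (\bigcup_j G j) (uncons x).2 by rewrite -TG.
  exists (maxn i j) => //; split.
  - by move: Fi; apply/subsetPset/ndF/leq_maxl.
  - by move: Gj; apply/subsetPset/ndG/leq_maxr.
have muncons : measurable_fun setT uncons.
  apply/measurable_fun_pairP; split.
  - exact: (measurable_tnth (T := R) ord0).
  - exact: measurable_behead.
move=> k; have [mF Fk] := Foo k; have [mG Gk] := Goo k; split.
  by rewrite -[X in measurable X]setTI; apply: muncons => //; exact: measurableX.
rewrite /lebesgue_step /pushforward (_ : _ @^-1` _ = F k `*` G k).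
  by rewrite product_measure1E// lte_mul_pinfty// ge0_fin_numE.
by rewrite -comp_preimage (_ : uncons \o _ = id) ?preimage_id//; exact/funext.
Qed.

HB.instance Definition _ := Measure_isSigmaFinite.Build _ _ _ nu
  nu_sigma_finite.

Lemma lebesgue_stepE :
  exists nu' : {sigma_finite_measure set (n.+1.-tuple R) -> \bar R},
  nu' = pushforward (@lebesgue_measure R \x mu)%E (@consT n)
    :> (set _ -> \bar R).
Proof. by exists nu. Qed.

End step.

Lemma lebesgue_tuple_subproof n :
  exists mu : {sigma_finite_measure set (n.-tuple R) -> \bar R},
  mu = @lebesgue_tuple n :> (set _ -> \bar R).
Proof.
elim: n => [|n [mu muE]]; first by exists \d_[tuple].
by have [nu nuE] := lebesgue_stepE mu; exists nu; rewrite nuE muE.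
Qed.

Section instances.
Variable n : nat.
Local Notation lam := (@lebesgue_tuple n).

Let lam0 : lam set0 = 0%E.
Proof. by have [mu <-] := lebesgue_tuple_subproof n. Qed.

Let lam_ge0 A : (0 <= lam A)%E.
Proof. by have [mu <-] := lebesgue_tuple_subproof n. Qed.

Let lam_sigma_additive : semi_sigma_additive lam.
Proof.
by have [mu <-] := lebesgue_tuple_subproof n; exact: measure_semi_sigma_additive.
Qed.

HB.instance Definition _ := isMeasure.Build _ _ _ lam
  lam0 lam_ge0 lam_sigma_additive.

Let lam_sigma_finite : sigma_finite setT lam.
Proof. by have [mu <-] := lebesgue_tuple_subproof n; exact: sigma_finiteT. Qed.

HB.instance Definition _ := Measure_isSigmaFinite.Build _ _ _ lam
  lam_sigma_finite.

End instances.
End lebesgue_measure_tuple.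

Section probability.
Context {R : realType}.

(* Density of N(0, S) with respect to Lebesgue measure, for S positive
   definite. *)
Definition gauss_pdf p (S : 'M[R]_p) (x : p.-tuple R) : R :=
  (Num.sqrt ((2 * pi) ^+ p * \det S))^-1 * expR (- qform (invmx S) x / 2).

(* Laws are compared on measurable sets only: a measure is a total function
   whose values elsewhere carry no information. *)
Definition has_gaussian_law d (T : measurableType d) (P : probability T R) p
    (X : {RV P >-> p.-tuple R}) (S : 'M[R]_p) :=
  forall A : set (p.-tuple R), measurable A ->
    distribution P X A =
      (\int[@lebesgue_tuple R p]_(x in A) (gauss_pdf S x)%:E)%E.

Definition has_uniform01_law d (T : measurableType d) (P : probability T R)
    (s : {RV P >-> R}) :=
  forall A : set R, measurable A ->
    distribution P s A = uniform_prob (@ltr01 R) A.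

Definition independent_RV d (T : measurableType d) (P : probability T R)
    d1 (T1 : measurableType d1) d2 (T2 : measurableType d2)
    (X : {RV P >-> T1}) (Y : {RV P >-> T2}) :=
  forall (A : set T1) (B : set T2), measurable A -> measurable B ->
    P (X @^-1` A `&` Y @^-1` B) = (P (X @^-1` A) * P (Y @^-1` B))%E.

Definition Lop d (T : measurableType d) (P : probability T R) p
    (y : {RV P >-> p.-tuple R}) (s : {RV P >-> R}) (S0 S1 : 'M[R]_p)
    (h : p.-tuple R -> R -> R) : \bar R :=
  (2^-1%:E *
   'E_P[fun w => ((qform (dlogSigma S0 S1 (s w)) (y w)
                   - dlogdetSigma S0 S1 (s w)) * h (y w) (s w))%R])%E.

End probability.

(* Main.v *)
Require Import Defs.
From HB Require Import structures.
From mathcomp Require Import all_boot all_order all_algebra.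
From mathcomp Require Import all_classical all_reals all_analysis.
From mathcomp Require Import measurable_realfun complex ring lra.
Set Implicit Arguments.
Unset Strict Implicit.
Unset Printing Implicit Defensive.
Import Order.TTheory GRing.Theory Num.Theory.
Import numFieldNormedType.Exports.
Local Open Scope classical_set_scope.
Local Open Scope ring_scope.

(** Write V_s for the covariance matrix (1 - s) S0 + s S1, A for S1 - S0, and
    f_V for the density of N(0, V).

    Differentiating in s at a fixed point x gives
      2 (d/ds) f_(V_s)(x) =
        (x^T V_s^-1 A V_s^-1 x - (log det V_s)') f_(V_s)(x),
    so the fundamental theorem of calculus on [0, 1] ([integral_score])
    followed by Fubini's theorem expresses P(x1 in B_t) - P(x0 in B_t) as an
    average over s of integrals over the ball B_t ([integral_kernels]).

    At a fixed s, let B be the symmetric square root of V = V_s. Substituting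
    x = B y turns f_V(x) dx into the standard Gaussian law, the ball into the
    ellipsoid y^T V y < t, and the quadratic form into y^T B^-1 A B^-1 y.
    The theorem has y^T A V^-1 y instead. These two forms differ as functions
    of y, but they have the same integral over the ellipsoid: the integral of
    y^T N y is tr (N G), where G is the second moment matrix of the standard
    Gaussian vector restricted to the ellipsoid, and G commutes with B
    ([integral_ball_ellipsoid]). It commutes because an orthogonal matrix that
    commutes with V preserves both the Gaussian law and the ellipsoid, hence
    fixes G under conjugation; applied to the reflection in an eigenvector of
    V, this says that every eigenvector of V is an eigenvector of G
    ([reflection_invariant_comm]).

    The substitution x = B y relies on the linear change of variables for
    Lebesgue measure on R^n ([scales_lin]), obtained by induction on n from
    the one-dimensional case and Tonelli's theorem. The expectation over
    (y, s) is brought to an integral over R^p * R by the density of their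
    joint law ([joint_density]). *)

(** * Image measures, densities, null sets *)

(** Names the image measure as a measure, so that it can be used without
    carrying the proof that the map is measurable in its type. *)
Lemma pushforward_is_measure d1 d2 (T1 : measurableType d1)
    (T2 : measurableType d2) (R : realType) (mu : {measure set T1 -> \bar R})
    (phi : T1 -> T2) :
  measurable_fun setT phi ->
  exists m : {measure set T2 -> \bar R}, m = pushforward mu phi :> (set _ -> _).
Proof. by move=> mphi; unshelve eexists (pushforward mu phi). Qed.

Lemma ge0_integral_image d1 d2 (T1 : measurableType d1)
    (T2 : measurableType d2) (R : realType) (mu : {measure set T1 -> \bar R})
    (nu : {measure set T2 -> \bar R}) (phi : T1 -> T2) (f : T2 -> \bar R) :
  measurable_fun setT phi ->
  (forall A, measurable A -> nu A = mu (phi @^-1` A)) ->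
  measurable_fun setT f -> (forall x, 0 <= f x)%E ->
  (\int[nu]_y f y = \int[mu]_x f (phi x))%E.
Proof.
move=> mphi nuE mf f0.
have /= <- := ge0_integral_pushforward mphi mu measurableT mf (in1W f0).
apply: eq_measure_integral => // A mA _; exact: nuE.
Qed.

(** The positive and negative parts of [f] are transported separately. *)
Lemma integral_image d1 d2 (T1 : measurableType d1)
    (T2 : measurableType d2) (R : realType) (mu : {measure set T1 -> \bar R})
    (nu : {measure set T2 -> \bar R}) (phi : T1 -> T2) (f : T2 -> \bar R) :
  measurable_fun setT phi ->
  (forall A, measurable A -> nu A = mu (phi @^-1` A)) ->
  measurable_fun setT f ->
  (\int[nu]_y f y = \int[mu]_x f (phi x))%E.
Proof.
move=> mphi nuE mf; rewrite [LHS]integralE [RHS]integralE.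
rewrite (ge0_integral_image mphi nuE (measurable_funepos mf) (funepos_ge0 f)).
rewrite (ge0_integral_image mphi nuE (measurable_funeneg mf) (funeneg_ge0 f)).
by rewrite (funepos_comp f phi) (funeneg_comp f phi).
Qed.

Section density.
Local Open Scope ereal_scope.
Context d (T : measurableType d) (R : realType).
Variables (mu nu : {measure set T -> \bar R}) (w : T -> R).
Hypotheses (mw : measurable_fun setT w) (w0 : forall x, (0 <= w x)%R).
Hypothesis nuE : forall A, measurable A -> nu A = \int[mu]_(x in A) (w x)%:E.

Import HBNNSimple.

Let integral_density_indic E : measurable E ->
  \int[nu]_x (\1_E x)%:E = \int[mu]_x ((\1_E x)%:E * (w x)%:E).
Proof.
move=> mE; rewrite integral_indic// setIT nuE// [LHS]integral_mkcond/=.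
apply: eq_integral => x _; rewrite patchE indicE.
by case: ifPn => xE; rewrite ?mul1e ?mul0e.
Qed.

Let integral_density_nnsfun (h : {nnsfun T >-> R}) :
  \int[nu]_x (h x)%:E = \int[mu]_x ((h x)%:E * (w x)%:E).
Proof.
have mwE : measurable_fun setT (EFin \o w) by exact/measurable_EFinP.
under [LHS]eq_integral do rewrite fimfunE -fsumEFin//.
rewrite [LHS]ge0_integral_fsum//; last 2 first.
  - by move=> r; exact/measurable_EFinP/measurableT_comp.
  - by move=> n x _; rewrite EFinM nnfun_muleindic_ge0.
under [RHS]eq_integral.
  move=> x xD; rewrite fimfunE -fsumEFin// ge0_mule_fsuml; last first.
    by move=> r; rewrite EFinM nnfun_muleindic_ge0.
  over.
rewrite [RHS]ge0_integral_fsum//; last 2 first.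
  - move=> r; apply: emeasurable_funM => //.
    by apply/measurable_EFinP; do 2 apply/measurableT_comp => //.
  - move=> n x _; apply: mule_ge0; last by rewrite lee_fin.
    by rewrite EFinM nnfun_muleindic_ge0.
apply: eq_fsbigr => r _.
rewrite integralZl_indic_nnsfun//= integral_density_indic//.
have [r0|r0] := ltP r 0%R.
  rewrite preimage_nnfun0// !integral0_eq ?mule0// => x _;
  by rewrite indicE in_set0 ?mulr0 mul0e.
rewrite -ge0_integralZl//=.
- by apply: eq_integral => x _; rewrite EFinM muleA.
- apply: emeasurable_funM => //.
  by apply/measurable_EFinP.
- by move=> x _; rewrite mule_ge0// lee_fin.
Qed.

Lemma ge0_integral_density (f : T -> \bar R) :
  measurable_fun setT f -> (forall x, 0 <= f x) ->
  \int[nu]_x f x = \int[mu]_x (f x * (w x)%:E).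
Proof.
move=> mf f0.
have mwE : measurable_fun setT (EFin \o w) by exact/measurable_EFinP.
pose f_ := nnsfun_approx measurableT mf.
transitivity (lim (\int[nu]_x (f_ n x)%:E @[n --> \oo])).
  rewrite -monotone_convergence//=.
  - apply: eq_integral => ? /[!inE] xD; apply/esym/cvg_lim => //=.
    exact: cvg_nnsfun_approx.
  - by move=> n; exact/measurable_EFinP/measurable_funTS.
  - by move=> n ? _; rewrite lee_fin.
  - by move=> ? _ ? ? mn; rewrite lee_fin; exact/lefP/nd_nnsfun_approx.
transitivity (lim (\int[mu]_x ((f_ n x)%:E * (w x)%:E) @[n --> \oo])).
  by apply: congr_lim; apply/funext => n /=; exact: integral_density_nnsfun.
rewrite -monotone_convergence//=.
- apply: eq_integral => x _; apply/cvg_lim => //.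
  apply: cvgeZr => //.
  by apply: cvg_nnsfun_approx => //.
- move=> n; apply: emeasurable_funM => //.
  exact/measurable_EFinP/measurable_funTS.
- by move=> n x _; rewrite mule_ge0// lee_fin.
- move=> x _ m n mn; rewrite lee_pmul// ?lee_fin//; exact/lefP/nd_nnsfun_approx.
Qed.

(** Multiplying by the nonnegative density [w] commutes with taking positive
    and negative parts. *)
Lemma integral_density (f : T -> R) : measurable_fun setT f ->
  \int[nu]_x (f x)%:E = \int[mu]_x (f x * w x)%:E.
Proof.
move=> mf; have mfE : measurable_fun setT (EFin \o f) by exact/measurable_EFinP.
have fwE : (fun x => (f x * w x)%:E) = (fun x => (EFin \o f) x * (w x)%:E).
  by apply/funext => x; rewrite EFinM.
rewrite fwE [LHS]integralE [RHS]integralE.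
rewrite ge0_integral_density//; last exact: measurable_funepos.
rewrite ge0_integral_density//; last exact: measurable_funeneg.
congr (_ - _); apply: eq_integral => x _.
  rewrite !funeposE/= -EFinM -!EFin_max -EFinM; congr EFin.
  by rewrite mulrC maxr_pMr// mulr0 mulrC.
rewrite !funenegE/= -!EFin_max -EFinM; congr EFin.
by rewrite mulrC maxr_pMr// mulr0 mulrN mulrC.
Qed.

End density.

Section null_sets.
Local Open Scope ereal_scope.
Context d (T : measurableType d) (R : realType) (mu : {measure set T -> \bar R}).
Variables (N : set T) (mN : measurable N) (muN : mu N = 0).

Import HBNNSimple.

Let ge0_le_integral_off (f g : T -> \bar R) :
  (forall x, 0 <= f x) -> (forall x, 0 <= g x) -> (forall x, ~ N x -> f x = g x) ->
  \int[mu]_x f x <= \int[mu]_x g x.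
Proof.
move=> f0 g0 fg; rewrite !ge0_integralTE//.
apply: ub_ereal_sup => _ [h hf <-].
(* Killing a simple function on [N] keeps its integral and makes it smaller
   than [g]. *)
pose h' := mul_nnsfun h (indic_nnsfun R (measurableC mN)).
have h'E x : h' x = (h x * \1_(~` N) x)%R by [].
apply: (@le_trans _ _ (sintegral mu h')); last first.
  apply: ereal_sup_ubound; exists h' => // x; rewrite h'E indicE.
  have [|_] := boolP (x \in ~` N); last by rewrite mulr0.
  by rewrite inE => Nx; rewrite mulr1 -fg//; exact: hf.
rewrite le_eqVlt; apply/orP; left; apply/eqP.
rewrite -!integralT_nnsfun; apply: ge0_ae_eq_integral => //.
- exact/measurable_EFinP/measurable_funP.
- exact/measurable_EFinP/measurable_funP.
- by move=> x _; rewrite lee_fin.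
- by move=> x _; rewrite lee_fin.
exists N; split => // x; apply: contra_notP => Nx _.
by rewrite h'E indicE mem_set// mulr1.
Qed.

(** The integrand of the theorem contains the derivative of
    u |-> ln (det V_u), which is under control only for u in [0, 1]. Changing
    it elsewhere calls for a lemma about arbitrary functions. It holds because
    the integral of a nonnegative function is a supremum over the simple
    functions below it, and a simple function can be set to 0 on [N]. *)
Lemma integral_off_null (f g : T -> \bar R) : (forall x, ~ N x -> f x = g x) ->
  \int[mu]_x f x = \int[mu]_x g x.
Proof.
move=> fg; rewrite [LHS]integralE [RHS]integralE; congr (_ - _);
  apply/eqP; rewrite eq_le !ge0_le_integral_off// => x Nx;
  by rewrite ?funeposE ?funenegE fg.
Qed.

End null_sets.

(** * Linear change of variables for Lebesgue measure on tuples *)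

Section scaling_maps.
Context d (T : measurableType d) (R : realType).
Variable mu : {measure set T -> \bar R}.

(** The preimage of a set under [phi] has 1 / [k] times the measure of the set.
    Stated on nonnegative functions, the property composes and fits Tonelli's
    theorem. *)
Definition scales (k : R) (phi : T -> T) :=
  measurable_fun setT phi /\
  forall f : T -> \bar R, measurable_fun setT f -> (forall x, 0 <= f x)%E ->
    (k%:E * \int[mu]_x f (phi x) = \int[mu]_x f x)%E.

Lemma scales_comp k l phi psi :
  scales k phi -> scales l psi -> scales (k * l) (phi \o psi).
Proof.
move=> [mphi kphi] [mpsi kpsi]; split; first exact: measurableT_comp.
move=> f mf f0; rewrite EFinM -muleA.
rewrite (kpsi (f \o phi)) ?kphi//; last by move=> x; exact: f0.
exact: measurableT_comp.
Qed.

End scaling_maps.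

Section affine_line.
Context {R : realType}.
Local Notation mu := (@lebesgue_measure R).

Definition affine (a b : R) (r : measurableTypeR R) : measurableTypeR R :=
  a * r + b.

Lemma measurable_affine a b : measurable_fun setT (affine a b).
Proof. by apply: measurable_funD => //; exact: measurable_funM. Qed.

(** By uniqueness of Lebesgue measure it suffices to look at the intervals
    ]x, y]; for a < 0 the preimage is closed on the other side, which does not
    change its length. *)
Lemma lebesgue_measure_affine a b (A : set (measurableTypeR R)) :
  a != 0 -> measurable A ->
  (`|a|%:E * mu (affine a b @^-1` A) = mu A)%E.
Proof.
move=> a0 mA.
have [m mE] := pushforward_is_measure mu (measurable_affine a b).
transitivity (mscale `|a|%:nng m A); first by rewrite /mscale/= mE.
apply/esym/lebesgue_measure_unique => // _ [[x y] _ <-] /=.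
rewrite /mscale/= mE /pushforward lebesgue_measure_itv/= lte_fin.
have [a_gt0|a_lt0|a_eq0] := ltgtP 0 a; last by rewrite -a_eq0 eqxx in a0.
- rewrite (_ : _ @^-1` _ = `](x - b) / a, (y - b) / a]%classic); last first.
    apply/seteqP; split => r /=; rewrite !in_itv/= ltr_pdivrMr// ler_pdivlMr//;
    by rewrite ltrBlDr lerBrDr mulrC.
  have -> := @lebesgue_measure_itv R `](x - b) / a, (y - b) / a].
  rewrite /= lte_fin ltr_pM2r ?invr_gt0// ltrD2r.
  case: ifP => xy; last by rewrite mule0.
  rewrite gtr0_norm// -!EFinB -EFinM -mulrBl mulrC divfK//; congr EFin.
  by rewrite opprB addrA subrK.
- rewrite (_ : _ @^-1` _ = `[(y - b) / a, (x - b) / a[%classic); last first.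
    apply/seteqP; split => r /=; rewrite !in_itv/= ltr_ndivlMr// ler_ndivrMr//;
    by rewrite ltrBlDr lerBrDr mulrC andbC.
  have -> := @lebesgue_measure_itv R `[(y - b) / a, (x - b) / a[.
  rewrite /= lte_fin ltr_nM2r ?invr_lt0// ltrD2r.
  case: ifP => xy; last by rewrite mule0.
  rewrite ltr0_norm// -!EFinB -EFinM -mulrBl mulNr mulrC divfK//; congr EFin.
  by rewrite !opprB addrA subrK.
Qed.

Lemma scales_affine a b : a != 0 -> scales mu `|a| (affine a b).
Proof.
move=> a0; split; first exact: measurable_affine.
move=> f mf f0.
have [m mE] := pushforward_is_measure mu (measurable_affine a b).
rewrite -(ge0_integral_image (nu := m) (measurable_affine a b))//; last first.
  by move=> A mA; rewrite mE.
have /= <- := ge0_integral_mscale m measurableT `|a|%:nng mf (fun x _ => f0 x).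
apply: eq_measure_integral => A mA _.
by transitivity (`|a|%:E * m A)%E => //; rewrite mE lebesgue_measure_affine.
Qed.

End affine_line.

Section lebesgue_tuple_tonelli.
Context {R : realType}.
Local Notation mu := (@lebesgue_measure R).

Lemma ge0_integral_lebesgue_tupleS n (f : n.+1.-tuple R -> \bar R) :
  measurable_fun setT f -> (forall x, 0 <= f x)%E ->
  (\int[@lebesgue_tuple R n.+1]_x f x =
   \int[mu]_a \int[@lebesgue_tuple R n]_x f (consT (a, x)))%E.
Proof.
move=> mf f0.
rewrite (ge0_integral_image (mu := (mu \x @lebesgue_tuple R n)%E)
  (@measurable_consT R n))//.
have /= := @fubini_tonelli1 _ _ _ _ R mu (@lebesgue_tuple R n) (f \o @consT R n) => ->//.
  exact: measurableT_comp (@measurable_consT R n).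
Qed.

Lemma ge0_integral_lebesgue_tupleS_swap n (f : n.+1.-tuple R -> \bar R) :
  measurable_fun setT f -> (forall x, 0 <= f x)%E ->
  (\int[@lebesgue_tuple R n.+1]_x f x =
   \int[@lebesgue_tuple R n]_x \int[mu]_a f (consT (a, x)))%E.
Proof.
move=> mf f0; rewrite ge0_integral_lebesgue_tupleS//.
have /= := @fubini_tonelli _ _ _ _ R mu (@lebesgue_tuple R n) (f \o @consT R n).
by apply => //; exact: measurableT_comp (@measurable_consT R n).
Qed.

Lemma measurable_consT_pair1 n (a : R) :
  measurable_fun setT (fun x : n.-tuple R => consT (a, x)).
Proof.
exact: (measurableT_comp (@measurable_consT R n) (pair1_measurable a)).
Qed.

Lemma measurable_consT_pair2 n (x : n.-tuple R) :
  measurable_fun setT (fun a : measurableTypeR R => consT (a : R, x)).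
Proof.
exact: (measurableT_comp (@measurable_consT R n) (pair2_measurable x)).
Qed.

(** Integrate over the tail first: at a fixed first coordinate the tail is
    moved by [psi r], and then the first coordinate by an affine map. *)
Lemma scales_skewl n k (psi : R -> n.-tuple R -> n.-tuple R) a b
    (phi : n.+1.-tuple R -> n.+1.-tuple R) :
  a != 0 -> (forall r, scales (@lebesgue_tuple R n) k (psi r)) -> 0 <= k ->
  measurable_fun setT phi ->
  (forall r x, phi (consT (r, x)) = consT (a * r + b, psi r x)) ->
  scales (@lebesgue_tuple R n.+1) (`|a| * k) phi.
Proof.
move=> a0 kpsi k0 mphi phiE; split => // f mf f0.
have mfphi : measurable_fun setT (fun x => f (phi x)).
  exact: measurableT_comp.
have mF : measurable_fun setT
    (fun r : measurableTypeR R => \int[@lebesgue_tuple R n]_x f (consT (r, x)))%E.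
  apply: (measurable_fun_fubini_tonelli_F (f \o @consT R n)) => //.
    exact: measurableT_comp (@measurable_consT R n).
  by move=> x; exact: f0.
have mF' : measurable_fun setT
    (fun r : measurableTypeR R =>
      \int[@lebesgue_tuple R n]_x f (phi (consT (r, x))))%E.
  apply: (measurable_fun_fubini_tonelli_F (f \o phi \o @consT R n)) => //.
    apply: measurableT_comp (@measurable_consT R n).
    exact: measurableT_comp.
  by move=> x; exact: f0.
rewrite !ge0_integral_lebesgue_tupleS// EFinM -muleA.
rewrite -ge0_integralZl//; last by move=> r _; exact: integral_ge0.
have [_ /(_ _ mF) <-] := scales_affine b a0; last first.
  by move=> r; exact: integral_ge0.
congr *%E; apply: eq_integral => r _.
under eq_integral do rewrite phiE.
have [_ /(_ (fun x => f (consT (a * r + b, x)))) ->//] := kpsi r.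
exact: measurableT_comp (measurable_consT_pair1 _).
Qed.

(** Integrate over the first coordinate first: at a fixed tail it is moved by a
    translation. *)
Lemma scales_skewr n (b : n.-tuple R -> R)
    (phi : n.+1.-tuple R -> n.+1.-tuple R) :
  measurable_fun setT phi ->
  (forall r x, phi (consT (r, x)) = consT (r + b x, x)) ->
  scales (@lebesgue_tuple R n.+1) 1 phi.
Proof.
move=> mphi phiE; split => // f mf f0.
have mfphi : measurable_fun setT (fun x => f (phi x)).
  exact: measurableT_comp.
rewrite !ge0_integral_lebesgue_tupleS_swap// mul1e.
apply: eq_integral => x _.
have mfx : measurable_fun setT (fun r : measurableTypeR R => f (consT (r : R, x))).
  exact: measurableT_comp (measurable_consT_pair2 _).
have [_ /(_ _ mfx) <-//] := scales_affine (b x) (oner_neq0 R).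
rewrite normr1 mul1e; apply: eq_integral => r _.
by rewrite phiE /affine mul1r.
Qed.

End lebesgue_tuple_tonelli.

Section linear_change_of_variables.
Context {R : realType}.

Definition lin n (A : 'M[R]_n) (x : n.-tuple R) : n.-tuple R :=
  [tuple (A *m tcol x) i 0 | i < n].

Definition translate n (c : 'cV[R]_n) (x : n.-tuple R) : n.-tuple R :=
  [tuple tnth x i + c i 0 | i < n].

Lemma tcol_lin n (A : 'M[R]_n) x : tcol (lin A x) = A *m tcol x.
Proof. by apply/colP => i; rewrite !mxE tnth_mktuple mxE. Qed.

Lemma lin_mulmx n (A B : 'M[R]_n) : lin (A *m B) = lin A \o lin B.
Proof.
by apply/funext => x; apply: eq_mktuple => i; rewrite tcol_lin mulmxA.
Qed.

Lemma tcol_inj n : injective (@tcol R n).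
Proof.
move=> x y /colP xy; apply: eq_from_tnth => i.
by have := xy i; rewrite !mxE.
Qed.

Lemma measurable_lin n (A : 'M[R]_n) : measurable_fun setT (lin A).
Proof.
apply/measurable_fun_tnthP => i.
rewrite (_ : _ \o _ = fun x => \sum_j A i j * tnth x j).
  apply: measurable_sum => j; apply: measurable_funM => //.
  exact: measurable_tnth.
apply/funext => x /=; rewrite tnth_mktuple mxE.
by apply: eq_bigr => j _; rewrite mxE.
Qed.

Lemma measurable_translate n (c : 'cV[R]_n) : measurable_fun setT (translate c).
Proof.
apply/measurable_fun_tnthP => i.
rewrite (_ : _ \o _ = fun x => tnth x i + c i 0).
  by apply: measurable_funD => //; exact: measurable_tnth.
by apply/funext => x /=; rewrite tnth_mktuple.
Qed.

Lemma tcol_consT n (r : R) (x : n.-tuple R) :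
  tcol (consT (r, x)) = col_mx r%:M (tcol x) :> 'cV_(1 + n).
Proof.
apply/colP => i; rewrite !mxE; case: splitP => j ji.
  rewrite ord1 mxE eqxx (_ : i = ord0) ?tnth0//.
  by apply: val_inj; rewrite /= ji ord1.
rewrite mxE (_ : i = lift ord0 j) ?tnthS//.
by apply: val_inj; rewrite /= ji.
Qed.

Lemma scales_tuple0 (phi : 0.-tuple R -> 0.-tuple R) :
  scales (@lebesgue_tuple R 0) 1 phi.
Proof.
have -> : phi = id by apply/funext => x; rewrite tuple0 [RHS]tuple0.
by split => // f mf f0; rewrite mul1e.
Qed.

Lemma scales_translate n (c : 'cV[R]_n) :
  scales (@lebesgue_tuple R n) 1 (translate c).
Proof.
elim: n c => [|n ih] c; first exact: scales_tuple0.
have := @scales_skewl R n 1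
  (fun=> translate (\col_i c (lift ord0 i) 0)) 1 (c 0 0) (translate c).
rewrite normr1 mulr1; apply => //.
- exact: measurable_translate.
- move=> r x; apply: eq_from_tnth => i; rewrite tnth_mktuple mul1r.
  case: (unliftP ord0 i) => [j|] ->.
    by rewrite !tnthS tnth_mktuple mxE.
  by rewrite !tnth0.
Qed.

Lemma scales_shear n (b : 'rV[R]_n) :
  scales (@lebesgue_tuple R n.+1) 1
    (lin (block_mx 1 b 0 1%:M : 'M[R]_(1 + n))).
Proof.
apply: (@scales_skewr _ _ (fun x => (b *m tcol x) 0 0)).
  exact: measurable_lin.
move=> r x; apply: tcol_inj; rewrite tcol_lin !tcol_consT.
rewrite (mul_block_col 1 b 0 1%:M r%:M (tcol x)).
rewrite mul1mx mul0mx mul1mx add0r.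
have -> // : r%:M + b *m tcol x = (r + (b *m tcol x) 0 0)%:M.
by apply/colP => i; rewrite !ord1 !mxE eqxx.
Qed.

Lemma scales_lblock n (a : R) (c : 'cV[R]_n) (S : 'M[R]_n) : a != 0 ->
  scales (@lebesgue_tuple R n) `|\det S| (lin S) ->
  scales (@lebesgue_tuple R n.+1) `|\det (block_mx a%:M 0 c S)|
    (lin (block_mx a%:M 0 c S : 'M[R]_(1 + n))).
Proof.
move=> a0 hS; rewrite det_lblock det_scalar1 normrM.
apply: (@scales_skewl _ _ _ (fun r => translate (r *: c) \o lin S) _ 0) => //.
- move=> r; rewrite -[`|_|]mul1r.
  by apply: scales_comp => //; exact: scales_translate.
- exact: measurable_lin.
move=> r x; apply: tcol_inj; rewrite tcol_lin !tcol_consT.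
rewrite (mul_block_col a%:M 0 c S r%:M (tcol x)).
rewrite mul0mx !addr0 -scalar_mxM.
have -> // : c *m r%:M + S *m tcol x = tcol (translate (r *: c) (lin S x)).
apply/colP => i; rewrite mul_mx_scalar [RHS]mxE tnth_mktuple tnth_mktuple.
by rewrite [LHS]mxE addrC.
Qed.

(** Induction on the dimension. If the upper left entry a of A is nonzero, A
    is a lower block triangular matrix with blocks a and S (the Schur
    complement) times a shear. Otherwise some entry of the first column is
    nonzero, and adding its row to the first row reduces to that case. *)
Theorem scales_lin n (A : 'M[R]_n) : A \in unitmx ->
  scales (@lebesgue_tuple R n) `|\det A| (lin A).
Proof.
elim: n A => [|n ih] A uA.
  by rewrite det_mx00 normr1; exact: scales_tuple0.
pose U (b : 'rV[R]_n) : 'M[R]_(1 + n) := block_mx 1 b 0 1%:M.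
have detU b : \det (U b) = 1 by rewrite det_ublock !det1 mulr1.
have scalesU b : scales (@lebesgue_tuple R n.+1) `|\det (U b)| (lin (U b)).
  by rewrite detU normr1; exact: scales_shear.
have UU b : U (- b) *m U b = 1%:M.
  rewrite mulmx_block !mul1mx !mul0mx !mulmx0 !mulmx1 !addr0 !add0r addrN.
  by rewrite -scalar_mx_block.
have closed (B C : 'M[R]_(1 + n)) :
    scales (@lebesgue_tuple R n.+1) `|\det B| (lin B) ->
    scales (@lebesgue_tuple R n.+1) `|\det C| (lin C) ->
    scales (@lebesgue_tuple R n.+1) `|\det (B *m C)| (lin (B *m C)).
  by move=> hB hC; rewrite det_mulmx normrM lin_mulmx; exact: scales_comp.
have pivot (B : 'M[R]_(1 + n)) : B \in unitmx -> B 0 0 != 0 ->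
    scales (@lebesgue_tuple R n.+1) `|\det B| (lin B).
  move=> uB B00.
  pose a := B 0 0; pose b := a^-1 *: ursubmx B.
  pose S := drsubmx B - dlsubmx B *m b.
  have BE : B = block_mx a%:M 0 (dlsubmx B) S *m U b.
    rewrite mulmx_block !mulmx1 mul0mx !mulmx0 !addr0 !mul_scalar_mx.
    rewrite /S /b scalerA divff// scale1r addrC subrK.
    rewrite -[LHS]submxK [ulsubmx B]mx11_scalar; congr (block_mx _%:M _ _ _).
    by rewrite !mxE; congr (B _ _); exact: val_inj.
  rewrite BE; apply: closed => //; apply: scales_lblock => //; apply: ih.
  move: uB; rewrite BE unitmx_mul => /andP[+ _].
  by rewrite !unitmxE det_lblock unitrM => /andP[].
have [A00|A00] := eqVneq (A 0 0) 0; last exact: pivot.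
have [i Ai0] : exists i : 'I_n, A (lift 0 i) 0 != 0.
  apply/existsP; apply: contraLR uA; rewrite negb_exists => /forallP A0.
  rewrite unitmxE (expand_det_col _ 0) big1 ?unitr0// => j _.
  case: (unliftP ord0 j) => [k|] ->; last by rewrite A00 mul0r.
  by have := A0 k; rewrite negbK => /eqP ->; rewrite mul0r.
have -> : A = U (- delta_mx 0 i) *m (U (delta_mx 0 i) *m A).
  by rewrite mulmxA UU mul1mx.
apply: closed => //; apply: pivot.
  by rewrite unitmx_mul uA andbT unitmxE detU unitr1.
have Ur (b : 'rV[R]_n) k : U b 0 (lift 0 k) = b 0 k.
  rewrite -(block_mxEur 1 b 0 1%:M 0 k); congr (block_mx _ _ _ _ _ _);
  exact: val_inj.
rewrite mxE (bigD1 (lift 0 i))//= big1 => [|j ji].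
  by rewrite addr0 Ur mxE !eqxx mul1r.
case: (unliftP ord0 j) ji => [k|] ->; last by rewrite A00 mulr0.
by rewrite (inj_eq (@lift_inj _ _)) Ur mxE eqxx => /negbTE ->; rewrite mul0r.
Qed.

(** With the factor inside the integral, it can be absorbed in the positive
    and negative parts of [f], each of which is rescaled by [scales_lin]. *)
Lemma integral_lin n (B : 'M[R]_n) (f : n.-tuple R -> \bar R) : B \in unitmx ->
  measurable_fun setT f ->
  (\int[@lebesgue_tuple R n]_x f x =
   \int[@lebesgue_tuple R n]_x (`|\det B|%:E * f (lin B x)))%E.
Proof.
move=> uB mf; have [mB sB] := scales_lin uB.
rewrite [LHS]integralE [RHS]integralE.
have det0 := normr_ge0 (\det B).
rewrite (ge0_funeposM (f \o lin B))// (ge0_funenegM (f \o lin B))//.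
have mfB : measurable_fun setT (f \o lin B) by exact: measurableT_comp.
rewrite !ge0_integralZl//=; last 2 first.
- exact: measurable_funeneg.
- exact: measurable_funepos.
rewrite (funepos_comp f (lin B)) (funeneg_comp f (lin B)); congr (_ - _)%E.
  by have /= <- := sB _ (measurable_funepos mf) (funepos_ge0 f).
by have /= <- := sB _ (measurable_funeneg mf) (funeneg_ge0 f).
Qed.

End linear_change_of_variables.

(** * Symmetric and positive definite matrices *)

Section symmetric_matrices.
Context {R : realType} {n : nat}.
Implicit Types (S P B G H : 'M[R]_n) (d : 'rV[R]_n).

(** The complex spectral theorem diagonalizes S with a real spectrum, and two
    real matrices similar over the complex field are similar over the reals.
    The base change [P] obtained in this way need not be orthogonal. *)
Lemma sym_diagonalizable S : S^T = S ->
  exists P d, P \in unitmx /\ P *m S = diag_mx d *m P.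
Proof.
move=> Ssym; pose f : {rmorphism R -> R[i]} := real_complex R.
have freal (m k : nat) (M : 'M[R]_(m, k)) : map_mx f M \is a mxOver Num.real.
  by apply/mxOverP => i j; rewrite mxE; apply/complex_realP; exists (M i j).
have mapRe (m k : nat) (M : 'M[R[i]]_(m, k)) : M \is a mxOver Num.real ->
    M = map_mx f (map_mx (@complex.Re R) M).
  move=> /mxOverP Mreal; apply/matrixP => i j; rewrite !mxE.
  by rewrite [RHS]RRe_real.
pose C := map_mx f S.
have Cherm : C \is hermsymmx.
  apply: realsym_hermsym; last exact: freal.
  apply/is_hermitianmxP; rewrite expr0 scale1r map_mx_id//.
  by rewrite /C map_trmx Ssym.
have /orthomx_spectralP CE := hermitian_normalmx Cherm.
have sreal := hermitian_spectral_diag_real Cherm.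
have Uunit := spectral_unit C.
have Dreal : diag_mx (spectral_diag C) \is a mxOver Num.real.
  by rewrite (mapRe _ _ _ sreal) -map_diag_mx; exact: freal.
have [] := @real_similar _ _ C (diag_mx (spectral_diag C)) _ (freal _ _ _) Dreal.
  exists (spectralmx C) => //; apply/(similarP Uunit).
  by have := congr1 (mulmx (spectralmx C)) CE; rewrite !mulmxA mulmxV// mul1mx.
move=> Q /andP[Qreal Qunit] /(similarP Qunit) QE.
exists (map_mx (@complex.Re R) Q), (map_mx (@complex.Re R) (spectral_diag C)).
split; first by rewrite -(map_unitmx f) -mapRe.
apply: (map_mx_inj (f := f)).
by rewrite !map_mxM /= map_diag_mx -!mapRe.
Qed.

(** [P *m P^T] commutes with the diagonal matrix of eigenvalues, hence vanishes
    off the blocks of equal eigenvalues, hence commutes with any function of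
    them. This replaces the orthogonality of [P] in the proof that the square
    root built from [P] is symmetric. *)
Lemma diag_commute_sqrt S P d : S^T = S -> P *m S = diag_mx d *m P ->
  let K := P *m P^T in
  diag_mx (map_mx Num.sqrt d) *m K = K *m diag_mx (map_mx Num.sqrt d).
Proof.
move=> Ssym PS K.
have DK : diag_mx d *m K = K *m diag_mx d.
  have <- : (diag_mx d *m K)^T = K *m diag_mx d.
    by rewrite trmx_mul tr_diag_mx /K trmx_mul trmxK.
  by rewrite /K mulmxA -PS !trmx_mul trmxK Ssym mulmxA.
move: K DK => K DK; apply/matrixP => i j; move/matrixP: DK => /(_ i j).
rewrite !mul_diag_mx !mul_mx_diag !mxE => Kij.
have [->|K0] := eqVneq (K i j) 0; first by rewrite mulr0 mul0r.
by move: Kij; rewrite mulrC => /(mulfI K0) ->; rewrite mulrC.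
Qed.

Lemma row_unitmx_neq0 P i : P \in unitmx -> row i P != 0.
Proof.
move=> uP; apply/eqP => rP.
have /matrixP/(_ 0 i)/eqP : delta_mx 0 i = 0 :> 'rV[R]_n.
  by rewrite -(mulmxK uP (delta_mx 0 i)) -rowE rP mul0mx.
by rewrite !mxE !eqxx oner_eq0.
Qed.

Lemma sqr_norm_gt0 (v : 'rV[R]_n) : v != 0 -> 0 < (v *m v^T) 0 0.
Proof.
move=> v0; rewrite mxE.
have vv k : v 0 k * v^T k 0 = v 0 k ^+ 2 by rewrite mxE expr2.
rewrite lt_neqAle eq_sym sumr_ge0 ?andbT => [|k _]; last by rewrite vv sqr_ge0.
apply: contra v0 => /eqP /psumr_eq0P vv0; apply/eqP/rowP => j.
apply/eqP; rewrite [X in _ == X]mxE -sqrf_eq0 -vv vv0// => k _.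
by rewrite vv sqr_ge0.
Qed.

Lemma posdefmx_eigenvalue_gt0 S P d : posdefmx S -> P \in unitmx ->
  P *m S = diag_mx d *m P -> forall i, 0 < d 0 i.
Proof.
move=> [Ssym Spos] uP PS i.
have v0 : (row i P)^T != 0.
  by rewrite -(inj_eq (@trmx_inj _ _ _)) trmxK trmx0 row_unitmx_neq0.
have := Spos _ v0; rewrite trmxK -row_mul PS row_mul.
rewrite row_diag_mx -scalemxAl -rowE -scalemxAl mxE pmulr_lgt0//.
by apply: sqr_norm_gt0; exact: row_unitmx_neq0.
Qed.

Lemma posdefmx_sqrt S : posdefmx S -> exists P d,
  let B := invmx P *m diag_mx (map_mx Num.sqrt d) *m P in
  [/\ P \in unitmx, P *m S = diag_mx d *m P, B^T = B & B *m B = S].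
Proof.
move=> Spd; have [Ssym _] := Spd.
have [P [d [uP PS]]] := sym_diagonalizable Ssym.
exists P, d => B; split => //; last first.
  rewrite /B !mulmxA mulmxK// -(mulmxA (invmx P)) mulmx_diag.
  apply: (can_inj (mulKmx uP)); rewrite !mulmxA mulmxV// mul1mx PS.
  congr (diag_mx _ *m _); apply/rowP => i; rewrite !mxE -expr2 sqr_sqrtr//.
  exact/ltW/(posdefmx_eigenvalue_gt0 Spd uP PS).
have uPT : P^T \in unitmx by rewrite unitmx_tr.
have EK := diag_commute_sqrt Ssym PS.
rewrite /B !trmx_mul tr_diag_mx trmx_inv mulmxA.
apply: (can_inj (mulmxK uPT)); rewrite mulmxKV//.
by apply: (can_inj (mulKmx uP)); rewrite !mulmxA mulmxV// mul1mx -[RHS]mulmxA EK.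
Qed.

Lemma posdefmx_det_gt0 S : posdefmx S -> 0 < \det S.
Proof.
move=> Spd; have [Ssym _] := Spd.
have [P [d [uP PS]]] := sym_diagonalizable Ssym.
have /(congr1 determinant) := PS; rewrite !det_mulmx mulrC => /(mulIf _) ->.
  rewrite det_diag; apply: prodr_gt0 => i _.
  exact: (posdefmx_eigenvalue_gt0 Spd uP PS).
by move: uP; rewrite unitmxE unitfE.
Qed.

Lemma posdefmx_unit S : posdefmx S -> S \in unitmx.
Proof. by move=> /posdefmx_det_gt0 detS; rewrite unitmxE unitfE gt_eqF. Qed.

Definition reflection (v : 'rV[R]_n) : 'M[R]_n :=
  1%:M - (2 / (v *m v^T) 0 0) *: (v^T *m v).

Lemma reflectionT v : (reflection v)^T = reflection v.
Proof. by rewrite /reflection linearB linearZ/= trmx1 trmx_mul trmxK. Qed.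

Lemma mul_reflection m (w : 'M[R]_(m, n)) (v : 'rV[R]_n) :
  w *m reflection v = w - (2 / (v *m v^T) 0 0) *: (w *m v^T *m v).
Proof. by rewrite mulmxBr mulmx1 -scalemxAr mulmxA. Qed.

Lemma mul_reflection_self v : v != 0 -> v *m reflection v = - v.
Proof.
move=> v0; have vv := sqr_norm_gt0 v0.
rewrite mul_reflection [v *m v^T]mx11_scalar mul_scalar_mx scalerA mxE eqxx.
by rewrite mulr1n divfK ?gt_eqF// scaler_nat mulr2n opprD addrA subrr add0r.
Qed.

Lemma reflectionK v : v != 0 -> reflection v *m reflection v = 1%:M.
Proof.
move=> v0; rewrite {1}/reflection mulmxBl mul1mx -scalemxAl -mulmxA.
rewrite mul_reflection_self// mulmxN scalerN opprK.
by rewrite /reflection subrK.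
Qed.

(** A symmetric matrix maps the orthogonal complement of its eigenvector [v] to
    itself, so it commutes with the reflection in [v]. *)
Lemma reflection_comm S v a : S^T = S -> v *m S = a *: v ->
  reflection v *m S = S *m reflection v.
Proof.
move=> Ssym vS; have Sv : S *m v^T = a *: v^T.
  by rewrite -[LHS]trmxK trmx_mul trmxK Ssym vS linearZ.
rewrite mulmxBl mulmxBr mul1mx mulmx1 -scalemxAl -scalemxAr -mulmxA vS.
by rewrite mulmxA Sv -scalemxAl -scalemxAr.
Qed.

(** If G is fixed under conjugation by the reflection, which negates [v], then
    the reflection also negates [v *m G]; only multiples of [v] are negated. *)
Lemma reflection_invariant_eigenvector G (v : 'rV[R]_n) : v != 0 ->
  reflection v *m G *m reflection v = G -> exists b, v *m G = b *: v.
Proof.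
move=> v0 HGH; set w := v *m G.
have wE : w = - (w *m reflection v).
  by rewrite {1}/w -HGH !mulmxA mul_reflection_self// !mulNmx.
exists ((w *m v^T) 0 0 / (v *m v^T) 0 0).
apply: (@scalerI _ _ (2 : R)); first by rewrite pnatr_eq0.
move: wE; rewrite mul_reflection [w *m v^T]mx11_scalar mul_scalar_mx scalerA.
move=> /eqP; rewrite opprB eq_sym subr_eq => /eqP wE.
by rewrite scaler_nat mulr2n -wE scalerA [_%:M 0 0]mxE eqxx mulr1n mulrA mulrAC.
Qed.

Lemma diag_commute S G P d : P \in unitmx -> P *m S = diag_mx d *m P ->
  (forall i, exists b, row i P *m G = b *: row i P) ->
  let B := invmx P *m diag_mx (map_mx Num.sqrt d) *m P in
  B *m G = G *m B.
Proof.
move=> uP PS /choice[g rPG] B.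
have PG : P *m G = diag_mx (\row_i g i) *m P.
  by apply/row_matrixP => i; rewrite !row_mul rPG row_diag_mx -scalemxAl -rowE mxE.
have GE : G = invmx P *m diag_mx (\row_i g i) *m P by rewrite -mulmxA -PG mulKmx.
rewrite /B GE !mulmxA !mulmxK//; congr (_ *m _).
by rewrite -!mulmxA diag_mxC.
Qed.

(** All eigenvectors of S are eigenvectors of G, so S and G are diagonalized by
    the same base change, and so is the square root of S. *)
Lemma reflection_invariant_comm S G : posdefmx S ->
  (forall H, H^T = H -> H *m H = 1%:M -> H *m S = S *m H -> H *m G *m H = G) ->
  exists B, [/\ B^T = B, B *m B = S & B *m G = G *m B].
Proof.
move=> Spd HGH; have [Ssym _] := Spd.
have [P [d [uP PS BT BB]]] := posdefmx_sqrt Spd.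
exists (invmx P *m diag_mx (map_mx Num.sqrt d) *m P); split => //.
apply: (@diag_commute S) => // i.
have v0 := row_unitmx_neq0 i uP.
apply: reflection_invariant_eigenvector => //; apply: HGH.
- exact: reflectionT.
- exact: reflectionK.
- apply: (reflection_comm (a := d 0 i)) => //.
  by rewrite -row_mul PS row_mul row_diag_mx -scalemxAl -rowE.
Qed.

End symmetric_matrices.

(** * Quadratic forms *)

Section quadratic_forms.
Context {R : realType} {n : nat}.
Implicit Types (A B S : 'M[R]_n) (x : n.-tuple R).

Lemma qformE A x :
  qform A x = \sum_i \sum_j A i j * (tnth x i * tnth x j).
Proof.
rewrite /qform mxE exchange_big/=; apply: eq_bigr => j _.
rewrite mxE big_distrl/=; apply: eq_bigr => i _.
by rewrite !mxE mulrA (mulrC (A i j)).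
Qed.

Lemma qform1E x : qform 1%:M x = \sum_i tnth x i ^+ 2.
Proof. by rewrite /qform mulmx1 mxE; apply: eq_bigr => i _; rewrite !mxE. Qed.

Lemma qform0 x : qform 0 x = 0.
Proof. by rewrite /qform mulmx0 mul0mx mxE. Qed.

Lemma qformZ c A x : qform (c *: A) x = c * qform A x.
Proof. by rewrite /qform -scalemxAr -scalemxAl mxE. Qed.

Lemma eballE (t : R) : 0 < t ->
  eball t = [set x : n.-tuple R | qform 1%:M x < t].
Proof.
move=> t0; apply/seteqP; split => x /=; rewrite /eball/= /enorm qform1E ltr_sqrt//.
Qed.

Lemma qform_lin A B x : qform A (lin B x) = qform (B^T *m A *m B) x.
Proof. by rewrite /qform tcol_lin trmx_mul !mulmxA. Qed.

Lemma measurable_qform A : measurable_fun setT (qform A).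
Proof.
rewrite (_ : qform A = fun x => \sum_i \sum_j A i j * (tnth x i * tnth x j)).
  apply: measurable_sum => i; apply: measurable_sum => j.
  apply: measurable_funM => //; apply: measurable_funM;
  exact: measurable_tnth.
by apply/funext => x; exact: qformE.
Qed.

Lemma posdefmx_ge0 S (v : 'cV[R]_n) : posdefmx S -> 0 <= (v^T *m S *m v) 0 0.
Proof.
move=> [_ Spos]; have [->|/Spos/ltW//] := eqVneq v 0.
by rewrite mulmx0 mxE.
Qed.

Lemma posdefmx1 : posdefmx (1%:M : 'M[R]_n).
Proof.
split; first by rewrite trmx1.
move=> v v0; rewrite mulmx1; have := @sqr_norm_gt0 R n v^T.
rewrite trmxK; apply; by rewrite -(inj_eq (@trmx_inj _ _ _)) trmxK trmx0.
Qed.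

Lemma posdefmx_inv S : posdefmx S -> posdefmx (invmx S).
Proof.
move=> Spd; have [Ssym Spos] := Spd; have uS := posdefmx_unit Spd.
split; first by rewrite trmx_inv Ssym.
move=> v v0; have -> : v^T *m invmx S *m v = (invmx S *m v)^T *m S *m (invmx S *m v).
  by rewrite trmx_mul trmx_inv Ssym -!mulmxA mulKVmx.
by apply: Spos; apply: contra v0 => /eqP Sv; rewrite -(mulKVmx uS v) Sv mulmx0.
Qed.

Lemma posdefmx_diag_gt0 S i : posdefmx S -> 0 < S i i.
Proof.
move=> [_ /(_ (delta_mx i 0))]; rewrite trmx_delta -rowE -colE !mxE; apply.
apply/eqP => /colP/(_ i); rewrite !mxE !eqxx => /eqP.
by rewrite oner_eq0.
Qed.

(** Cauchy-Schwarz for the scalar product defined by S, between x and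
    a = S^-1 e_i: their product is x_i, and the square of the norm of a is
    the i-th diagonal entry of S^-1. *)
Lemma sqr_tnth_le_qform S x i : posdefmx S ->
  tnth x i ^+ 2 <= invmx S i i * qform S x.
Proof.
move=> Spd; have [Ssym Spos] := Spd; have uS := posdefmx_unit Spd.
have k0 := posdefmx_diag_gt0 i (posdefmx_inv Spd).
set k := invmx S i i in k0 *.
pose v := tcol x; pose a := invmx S *m (delta_mx i 0 : 'cV[R]_n).
(* x - l a is the component of x that is S-orthogonal to a. *)
pose l := tnth x i / k.
have Sa : S *m a = delta_mx i 0 by rewrite mulKVmx.
have aS : a^T *m S = delta_mx 0 i by rewrite -[LHS]trmxK trmx_mul trmxK Ssym Sa trmx_delta.
have subE (M N : 'M[R]_1) : (M - N) 0 0 = M 0 0 - N 0 0 by rewrite !mxE.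
have scaleE c (M : 'M[R]_1) : (c *: M) 0 0 = c * M 0 0 by rewrite mxE.
have av : ((delta_mx 0 i : 'rV[R]_n) *m v) 0 0 = tnth x i by rewrite -rowE !mxE.
have va : (v^T *m (delta_mx i 0 : 'cV[R]_n)) 0 0 = tnth x i by rewrite -colE !mxE.
have aa : ((delta_mx 0 i : 'rV[R]_n) *m a) 0 0 = k by rewrite /a mulmxA -rowE -colE !mxE.
have := posdefmx_ge0 (v - l *: a) Spd.
have -> : (v - l *: a)^T = v^T - l *: a^T by rewrite linearB linearZ.
rewrite mulmxBl -scalemxAl aS mulmxBr mulmxBl mulmxBl -!scalemxAr -!scalemxAl.
rewrite -(mulmxA _ S a) Sa !subE !scaleE av va aa -/(qform S x).
have lk : l * k = tnth x i by rewrite /l divfK// gt_eqF.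
rewrite lk subrr subr0 subr_ge0 /l mulrAC -expr2 ler_pdivrMr//.
by rewrite mulrC.
Qed.

Lemma sqr_tnth_le_tr S x i : posdefmx S ->
  tnth x i ^+ 2 <= \tr (invmx S) * qform S x.
Proof.
move=> Spd; rewrite (le_trans (sqr_tnth_le_qform x i Spd))//.
rewrite ler_wpM2r ?posdefmx_ge0// /mxtrace (bigD1 i)//= lerDl sumr_ge0// => j _.
exact/ltW/posdefmx_diag_gt0/posdefmx_inv.
Qed.

Lemma qform_le A x M : (forall i, tnth x i ^+ 2 <= M) ->
  `|qform A x| <= (\sum_i \sum_j `|A i j|) * M.
Proof.
move=> xM; rewrite qformE big_distrl/= (le_trans (ler_norm_sum _ _ _))//.
apply: ler_sum => i _; rewrite big_distrl/= (le_trans (ler_norm_sum _ _ _))//.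
apply: ler_sum => j _; rewrite normrM ler_wpM2l// ler_norml.
have xi := xM i; have xj := xM j.
(* -2 M <= -(a^2 + b^2) <= 2 a b <= a^2 + b^2 <= 2 M *)
have h1 := sqr_ge0 (tnth x i - tnth x j).
have h2 := sqr_ge0 (tnth x i + tnth x j).
nra.
Qed.

End quadratic_forms.

(** * A Gaussian vector in a ball, at a fixed covariance matrix *)

Section gauss.
Context {R : realType} {n : nat}.

Lemma invmx_sqr (B : 'M[R]_n) : B \in unitmx ->
  invmx (B *m B) = invmx B *m invmx B.
Proof.
move=> uB; have uBB : B *m B \in unitmx by rewrite unitmx_mul uB.
by apply: (can_inj (mulKmx uBB)); rewrite mulmxV// -mulmxA mulKVmx// mulmxV.
Qed.

(** The substitution x = B y turns N(0, B^2) into the standard Gaussian law. *)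
Lemma gauss_pdf_lin (S B : 'M[R]_n) x : posdefmx S -> B^T = B -> B *m B = S ->
  `|\det B| * gauss_pdf S (lin B x) = gauss_pdf 1%:M x.
Proof.
move=> Spd BT BB; have detS := posdefmx_det_gt0 Spd.
have uB : B \in unitmx.
  by have := posdefmx_unit Spd; rewrite -BB unitmx_mul => /andP[].
have dB : 0 < `|\det B| by move: uB; rewrite normr_gt0 unitmxE unitfE.
have c0 : 0 <= (2 * pi) ^+ n :> R.
  by apply: exprn_ge0; apply: mulr_ge0 => //; exact: pi_ge0.
rewrite /gauss_pdf -BB qform_lin BT invmx_sqr// mulmxA mulmxV// mul1mx mulVmx//.
rewrite det_mulmx -expr2 det1 mulr1 sqrtrM// sqrtr_sqr invfM mulrA mulrCA.
by rewrite divff ?gt_eqF// mulr1 invmx1.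
Qed.

Lemma measurable_gauss_pdf (S : 'M[R]_n) : measurable_fun setT (gauss_pdf S).
Proof.
apply: measurable_funM => //; apply: measurableT_comp => //.
by apply: measurable_funM => //; apply: measurableT_comp => //; exact: measurable_qform.
Qed.

Lemma gauss_pdf_ge0 (S : 'M[R]_n) x : 0 <= gauss_pdf S x.
Proof. by rewrite mulr_ge0// ?invr_ge0 ?sqrtr_ge0// expR_ge0. Qed.

Definition ellipsoid_pdf (S : 'M[R]_n) (t : R) (x : n.-tuple R) : R :=
  (qform S x < t)%R%:R * gauss_pdf 1%:M x.

Lemma measurable_qform_lt (S : 'M[R]_n) t :
  measurable_fun setT (fun x => (qform S x < t)%R%:R : R).
Proof.
apply: measurableT_comp => //; apply: measurable_fun_ltr => //.
exact: measurable_qform.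
Qed.

Lemma measurable_ellipsoid_pdf S t : measurable_fun setT (ellipsoid_pdf S t).
Proof.
apply: measurable_funM; first exact: measurable_qform_lt.
exact: measurable_gauss_pdf.
Qed.

(** Ellipsoids are bounded: this makes every integrand below at most a constant
    times a Gaussian density or the indicator of a ball. *)
Lemma qform_indic_le (S N : 'M[R]_n) t x : posdefmx S -> 0 < t ->
  `|qform N x * (qform S x < t)%R%:R| <=
  (\sum_i \sum_j `|N i j|) * (\tr (invmx S) * t).
Proof.
move=> Spd t0.
have tr0 : 0 <= \tr (invmx S).
  by apply: sumr_ge0 => i _; exact/ltW/posdefmx_diag_gt0/posdefmx_inv.
have [xt|xt] := ltP (qform S x) t; last first.
  rewrite mulr0 normr0 mulr_ge0// ?mulr_ge0 ?(ltW t0)//.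
  by apply: sumr_ge0 => i _; apply: sumr_ge0.
rewrite mulr1; apply: qform_le => i.
by rewrite (le_trans (sqr_tnth_le_tr x i Spd))// ler_wpM2l// ltW.
Qed.

End gauss.

Section second_moments.
Context {R : realType} {n : nat} (S : 'M[R]_n) (t : R).
Hypotheses (Spd : posdefmx S) (t_gt0 : 0 < t).
Hypothesis phi_int : (@lebesgue_tuple R n).-integrable setT
  (EFin \o @gauss_pdf R n 1%:M).
Local Notation mu := (@lebesgue_tuple R n).
Local Notation w := (ellipsoid_pdf S t).

Lemma integrable_qform_ellipsoid N :
  mu.-integrable setT (fun x => (qform N x * w x)%:E).
Proof.
pose C := (\sum_i \sum_j `|N i j|) * (\tr (invmx S) * t).
apply: (@le_integrable _ _ _ _ _ _ _ (fun x => C%:E * (gauss_pdf 1%:M x)%:E)%E) => //.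
- apply/measurable_EFinP; apply: measurable_funM; first exact: measurable_qform.
  exact: measurable_ellipsoid_pdf.
- move=> x _; rewrite -EFinM !abse_EFin lee_fin mulrA.
  rewrite [leLHS]normrM [leRHS]normrM ler_wpM2r//.
  by rewrite (le_trans (qform_indic_le _ _ Spd t_gt0))// ler_norm.
- exact: integrableZl.
Qed.

(** The integrals of x_j x_i, these products being written as quadratic forms
    so that their integrability is an instance of
    [integrable_qform_ellipsoid]. *)
Definition second_moment : 'M[R]_n :=
  \matrix_(i, j) fine (\int[mu]_x (qform (delta_mx j i) x * w x)%:E)%E.

Lemma integral_qform_ellipsoid N :
  (\int[mu]_x (qform N x * w x)%:E = (\tr (N *m second_moment))%:E)%E.
Proof.
have qN x : qform N x = \sum_i \sum_j N i j * qform (delta_mx i j) x.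
  rewrite qformE; apply: eq_bigr => i _; apply: eq_bigr => j _; congr *%R.
  rewrite qformE (bigD1 i)//= [X in _ + X]big1 ?addr0 => [|k /negbTE ki]; last first.
    by apply: big1 => l _; rewrite mxE ki mul0r.
  rewrite (bigD1 j)//= big1 ?addr0 => [|k /negbTE kj].
    by rewrite mxE !eqxx mul1r.
  by rewrite mxE kj andbF mul0r.
transitivity (\int[mu]_x \sum_i \sum_j ((N i j)%:E *
    (qform (delta_mx i j) x * w x)%:E))%E.
  apply: eq_integral => x _; rewrite qN big_distrl/= -sumEFin.
  apply: eq_bigr => i _; rewrite big_distrl/= -sumEFin.
  by apply: eq_bigr => j _; rewrite -EFinM -mulrA.
have intij i j : mu.-integrable setT
    (fun x => (N i j)%:E * (qform (delta_mx i j) x * w x)%:E)%E.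
  by apply: integrableZl => //; exact: integrable_qform_ellipsoid.
rewrite integral_sum//; last by move=> i; exact: integrable_sum.
rewrite /mxtrace -sumEFin; apply: eq_bigr => i _.
rewrite integral_sum// mxE -sumEFin; apply: eq_bigr => j _.
rewrite integralZl//; last exact: integrable_qform_ellipsoid.
rewrite mxE EFinM fineK//; apply: integrable_fin_num => //.
exact: integrable_qform_ellipsoid.
Qed.

Lemma gauss_pdf1_lin (H : 'M[R]_n) x : H^T *m H = 1%:M ->
  gauss_pdf 1%:M (lin H x) = gauss_pdf 1%:M x.
Proof. by move=> HH; rewrite /gauss_pdf qform_lin invmx1 mulmx1 HH. Qed.

(** Such an H is orthogonal, so it preserves Lebesgue measure, the standard
    Gaussian density, and the ellipsoid. *)
Lemma second_moment_invariant (H : 'M[R]_n) : H^T = H -> H *m H = 1%:M ->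
  H *m S = S *m H -> H *m second_moment *m H = second_moment.
Proof.
move=> HT HH HS; have [uH _] := mulmx1_unit HH.
have dH : `|\det H| = 1.
  apply/eqP; rewrite -(@eqrXn2 _ 2)// expr1n -normrX expr2 -det_mulmx HH det1.
  by rewrite normr1.
have trE N : \tr (N *m second_moment) = \tr (N *m (H *m second_moment *m H)).
  apply: EFin_inj; rewrite -integral_qform_ellipsoid (integral_lin uH); last first.
    apply/measurable_EFinP; apply: measurable_funM; first exact: measurable_qform.
    exact: measurable_ellipsoid_pdf.
  rewrite dH.
  transitivity (\int[mu]_x (qform (H *m N *m H) x * w x)%:E)%E.
    apply: eq_integral => x _; rewrite mul1e /ellipsoid_pdf !qform_lin HT.
    by rewrite HS -(mulmxA S) HH mulmx1 gauss_pdf1_lin// HT.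
  by rewrite integral_qform_ellipsoid -!mulmxA mxtrace_mulC !mulmxA.
apply/matrixP => i j; have := trE (delta_mx j i).
have trd (M : 'M[R]_n) : \tr (delta_mx j i *m M) = M i j.
  rewrite /mxtrace (bigD1 j)//= big1 ?addr0 => [|k /negbTE kj]; last first.
    by rewrite mxE big1// => l _; rewrite mxE kj mul0r.
  rewrite mxE (bigD1 i)//= big1 ?addr0 => [|l /negbTE li].
    by rewrite mxE !eqxx mul1r.
  by rewrite mxE li andbF mul0r.
by rewrite !trd => ->.
Qed.

(** By cyclicity of the trace and B G = G B,
    tr (B^-1 A B^-1 G) = tr (A B^-1 G B^-1) = tr (A B^-1 B^-1 G). *)
Lemma integral_qform_symmetrize : exists B : 'M[R]_n,
  [/\ B^T = B, B *m B = S & forall A : 'M[R]_n,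
    (\int[mu]_x (qform (invmx B *m A *m invmx B) x * w x)%:E =
     \int[mu]_x (qform (A *m invmx S) x * w x)%:E)%E].
Proof.
have [B [BT BB BG]] := reflection_invariant_comm Spd second_moment_invariant.
exists B; split; [exact: BT|exact: BB|move=> A].
rewrite !integral_qform_ellipsoid; congr EFin.
have uB : B \in unitmx.
  by have := posdefmx_unit Spd; rewrite -BB unitmx_mul => /andP[].
have VBG : invmx B *m second_moment = second_moment *m invmx B.
  by apply: (can_inj (mulKmx uB)); rewrite mulKVmx// mulmxA BG mulmxK.
by rewrite -!mulmxA mxtrace_mulC -BB invmx_sqr// -!mulmxA VBG !mulmxA.
Qed.

(** The left-hand side comes from differentiating the density of N(0, S) in the
    direction A, with [L] the derivative of the logarithm of the determinant;
    the right-hand side is the expectation in the theorem at a fixed s. *)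
Lemma integral_ball_ellipsoid (A : 'M[R]_n) (L : R) :
  (\int[mu]_x (((qform (invmx S *m A *m invmx S) x - L) *
      (qform 1%:M x < t)%R%:R) * gauss_pdf S x)%:E =
   \int[mu]_x (((qform (A *m invmx S) x - L) *
      (qform S x < t)%R%:R) * gauss_pdf 1%:M x)%:E)%E.
Proof.
have [B [BT BB BA]] := integral_qform_symmetrize.
have uB : B \in unitmx.
  by have := posdefmx_unit Spd; rewrite -BB unitmx_mul => /andP[].
have w_int : mu.-integrable setT (fun x => (L * w x)%:E).
  apply: (@le_integrable _ _ _ _ _ _ _ (fun x => `|L|%:E * (gauss_pdf 1%:M x)%:E)%E) => //.
  - apply/measurable_EFinP; apply: measurable_funM => //.
    exact: measurable_ellipsoid_pdf.
  - move=> x _; rewrite -EFinM !abse_EFin lee_fin !normrM normr_id ler_wpM2l//.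
    by rewrite ler_piMl// normr_nat lern1 leq_b1.
  - exact: integrableZl.
have split_int N :
  (\int[mu]_x (((qform N x - L) * (qform S x < t)%R%:R) * gauss_pdf 1%:M x)%:E =
   \int[mu]_x (qform N x * w x)%:E - \int[mu]_x (L * w x)%:E)%E.
  rewrite -integralB//; last exact: integrable_qform_ellipsoid.
  by apply: eq_integral => x _; rewrite -EFinB -mulrBl -mulrA.
rewrite (integral_lin uB); last first.
  apply/measurable_EFinP; apply: measurable_funM; last exact: measurable_gauss_pdf.
  apply: measurable_funM; last exact: measurable_qform_lt.
  by apply: measurable_funB => //; exact: measurable_qform.
have BSB : B *m (invmx S *m A *m invmx S) *m B = invmx B *m A *m invmx B.
  by rewrite -BB invmx_sqr// !mulmxA mulmxV// mul1mx mulmxKV.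
rewrite split_int -BA -split_int; apply: eq_integral => x _.
by rewrite -EFinM mulrCA gauss_pdf_lin// !qform_lin BT mulmx1 BB BSB.
Qed.

End second_moments.

(** * The density along the segment of covariance matrices *)

Section polynomial_path.
Context {R : realType} {p : nat} (S0 S1 : 'M[R]_p).
Hypotheses (S0_pd : posdefmx S0) (S1_pd : posdefmx S1).
Local Notation V := (Sigma S0 S1).
Local Notation ev u := (map_mx (horner_eval u)).

(** The segment as a matrix of polynomials in s. Determinant and adjugate are
    then polynomials too, which gives continuity, measurability, bounds and
    derivatives of all that is built from V_s and its inverse. *)
Definition path_poly : 'M[{poly R}]_p :=
  map_mx polyC S0 + 'X *: map_mx polyC (S1 - S0).
Definition det_poly : {poly R} := \det path_poly.
Definition adj_poly : 'M[{poly R}]_p := \adj path_poly.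

Lemma ev_polyC u (M : 'M[R]_p) : ev u (map_mx polyC M) = M.
Proof. by apply/matrixP => i j; rewrite !mxE /horner_eval hornerC. Qed.

Lemma ev_path_poly u : ev u path_poly = V u.
Proof.
apply/matrixP => i j; rewrite !mxE /horner_eval !hornerE; ring.
Qed.

Lemma det_polyE u : det_poly.[u] = \det (V u).
Proof. by rewrite -ev_path_poly det_map_mx. Qed.

Lemma ev_adj_poly u : ev u adj_poly = \adj (V u).
Proof. by rewrite map_mx_adj ev_path_poly. Qed.

Lemma posdefmx_Sigma u : 0 <= u <= 1 -> posdefmx (V u).
Proof.
move=> /andP[u0 u1]; have [S0T S0p] := S0_pd; have [S1T S1p] := S1_pd.
split; first by rewrite /Sigma linearD !linearZ/= S0T S1T.
move=> v v0; rewrite /Sigma mulmxDr mulmxDl -!scalemxAr -!scalemxAl.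
have addE (M N : 'M[R]_1) : (M + N) 0 0 = M 0 0 + N 0 0 by rewrite mxE.
have scaleE c (M : 'M[R]_1) : (c *: M) 0 0 = c * M 0 0 by rewrite mxE.
rewrite addE !scaleE.
have [->|u_neq1] := eqVneq u 1.
  by rewrite subrr mul0r add0r mul1r S1p.
rewrite ltr_pwDl// ?mulr_gt0 ?S0p ?mulr_ge0// ?subr_gt0 ?lt_neqAle ?u_neq1//.
by rewrite ltW// S1p.
Qed.

Lemma det_poly_gt0 u : 0 <= u <= 1 -> 0 < det_poly.[u].
Proof. by move=> u01; rewrite det_polyE; exact/posdefmx_det_gt0/posdefmx_Sigma. Qed.

Lemma invmx_SigmaE u : det_poly.[u] != 0 ->
  invmx (V u) = det_poly.[u]^-1 *: ev u adj_poly.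
Proof.
rewrite det_polyE ev_adj_poly => detV.
by rewrite /invmx unitmxE unitfE detV.
Qed.

Lemma deriv_mulmx (M N : 'M[{poly R}]_p) :
  map_mx deriv (M *m N) = map_mx deriv M *m N + M *m map_mx deriv N.
Proof.
apply/matrixP => i j; rewrite !mxE raddf_sum -big_split/=.
by apply: eq_bigr => k _; rewrite derivM !mxE.
Qed.

Lemma deriv_path_poly : map_mx deriv path_poly = map_mx polyC (S1 - S0).
Proof.
by apply/matrixP => i j; rewrite !mxE derivD derivM derivX !derivC; ring.
Qed.

(** Differentiate adj V * V = det V, multiply on the right by adj V, and use
    V * adj V = det V. *)
Lemma deriv_adj_poly :
  det_poly *: map_mx deriv adj_poly - det_poly^`() *: adj_poly =
  - (adj_poly *m map_mx polyC (S1 - S0) *m adj_poly).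
Proof.
have /(congr1 (map_mx deriv)) := mul_adj_mx path_poly.
rewrite deriv_mulmx deriv_path_poly -/adj_poly -/det_poly.
have -> : map_mx deriv (det_poly%:M : 'M[{poly R}]_p) = (det_poly^`())%:M.
  by apply/matrixP => i j; rewrite !mxE; case: eqP => _; rewrite ?mulr1n ?mulr0n ?deriv0.
move=> /(congr1 (mulmx^~ adj_poly)).
rewrite mulmxDl -(mulmxA (map_mx deriv _)) mul_mx_adj -/det_poly mul_mx_scalar mul_scalar_mx.
by move=> <-; rewrite opprD addNKr.
Qed.

Definition quad_poly (M : 'M[{poly R}]_p) (x : p.-tuple R) : {poly R} :=
  \sum_i \sum_j M i j * (tnth x i * tnth x j)%:P.

Lemma quad_polyE M x u : (quad_poly M x).[u] = qform (ev u M) x.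
Proof.
rewrite qformE /quad_poly horner_sum; apply: eq_bigr => i _.
rewrite horner_sum; apply: eq_bigr => j _.
by rewrite hornerM hornerC mxE.
Qed.

Lemma deriv_quad_poly M x : (quad_poly M x)^`() = quad_poly (map_mx deriv M) x.
Proof.
rewrite /quad_poly raddf_sum; apply: eq_bigr => i _.
rewrite raddf_sum; apply: eq_bigr => j _ /=.
by rewrite derivM derivC mulr0 addr0 mxE.
Qed.

Lemma quad_polyZ (c : {poly R}) (M : 'M[{poly R}]_p) x :
  quad_poly (c *: M) x = c * quad_poly M x.
Proof.
rewrite /quad_poly big_distrr; apply: eq_bigr => i _.
by rewrite big_distrr; apply: eq_bigr => j _; rewrite mxE -mulrA.
Qed.

Lemma quad_polyN (M : 'M[{poly R}]_p) x : quad_poly (- M) x = - quad_poly M x.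
Proof. by rewrite -scaleN1r quad_polyZ mulN1r. Qed.

Lemma quad_polyB (M N : 'M[{poly R}]_p) x :
  quad_poly (M - N) x = quad_poly M x - quad_poly N x.
Proof.
rewrite -quad_polyN /quad_poly -big_split; apply: eq_bigr => i _ /=.
by rewrite -big_split; apply: eq_bigr => j _ /=; rewrite mxE mulrDl.
Qed.

Lemma qform_invE u x : det_poly.[u] != 0 ->
  qform (invmx (V u)) x = (quad_poly adj_poly x).[u] / det_poly.[u].
Proof. by move=> d0; rewrite invmx_SigmaE// qformZ quad_polyE mulrC. Qed.

(** Divided by the square of [det_poly], this is V^-1 A V^-1, the opposite of
    the derivative of V^-1. *)
Definition dinv_poly : 'M[{poly R}]_p :=
  adj_poly *m map_mx polyC (S1 - S0) *m adj_poly.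

Lemma qform_dinvE u x : det_poly.[u] != 0 ->
  qform (invmx (V u) *m (S1 - S0) *m invmx (V u)) x =
  (quad_poly dinv_poly x).[u] / det_poly.[u] ^+ 2.
Proof.
move=> d0; rewrite invmx_SigmaE// -!scalemxAr -!scalemxAl scalerA qformZ.
by rewrite quad_polyE !map_mxM /= ev_polyC -invfM expr2 mulrC.
Qed.

(** The quotient rule; its numerator is given by [deriv_adj_poly]. *)
Lemma is_derive_qform_inv u x : det_poly.[u] != 0 ->
  is_derive u 1 (fun v => (quad_poly adj_poly x).[v] / det_poly.[v])
    (- ((quad_poly dinv_poly x).[u] / det_poly.[u] ^+ 2)).
Proof.
move=> d0.
have dq := is_derive_poly (quad_poly adj_poly x) u.
have dd := is_deriveV d0 (is_derive_poly det_poly u).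
have /is_derive_eq := is_deriveM dq dd; apply.
have scE (a b : R) : a *: b = a * b by [].
rewrite !scE deriv_quad_poly.
have := congr1 (fun M => (quad_poly M x).[u]) deriv_adj_poly.
rewrite quad_polyB quad_polyN !quad_polyZ hornerD !hornerN !hornerM.
by move=> /(congr1 -%R); rewrite opprK => <-; field.
Qed.

Lemma dlogdetSigmaE u : 0 < det_poly.[u] ->
  dlogdetSigma S0 S1 u = det_poly^`().[u] / det_poly.[u].
Proof.
move=> d0; rewrite /dlogdetSigma derive1E.
have -> : (fun v => ln (\det (V v))) = @ln R \o horner det_poly.
  by apply/funext => v /=; rewrite det_polyE.
have := is_derive1_comp (is_derive1_ln d0) (is_derive_poly det_poly u).
by move=> [_ ->]; rewrite mulrC.
Qed.

(** The density of N(0, V_u) at [x] with the determinant moved into the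
    exponential, which makes it easy to differentiate in [u]. *)
Definition path_pdf (x : p.-tuple R) (u : R) : R :=
  (Num.sqrt ((2 * pi) ^+ p))^-1 *
  expR (- (ln det_poly.[u] + (quad_poly adj_poly x).[u] / det_poly.[u]) / 2).

Lemma path_pdfE x u : 0 < det_poly.[u] -> gauss_pdf (V u) x = path_pdf x u.
Proof.
move=> d0; rewrite /gauss_pdf /path_pdf qform_invE ?gt_eqF// -det_polyE.
have pi0 : 0 <= (2 * pi) ^+ p :> R.
  by apply: exprn_ge0; apply: mulr_ge0 => //; exact: pi_ge0.
rewrite sqrtrM// invfM -mulrA; congr *%R.
rewrite opprD mulrDl expRD; congr *%R.
by rewrite -powR12_sqrt ?ltW// /powR gt_eqF// mulNr expRN mulrC.
Qed.

(** Twice the derivative of ln f_(V_u)(x) in [u]. *)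
Definition score (x : p.-tuple R) (u : R) : R :=
  (quad_poly dinv_poly x).[u] / (det_poly ^+ 2).[u]
  - det_poly^`().[u] / det_poly.[u].

Lemma is_derive_path_pdf x u : 0 < det_poly.[u] ->
  is_derive u 1 (fun v => 2 * path_pdf x v) (score x u * path_pdf x u).
Proof.
move=> d0; have d_neq0 : det_poly.[u] != 0 by rewrite gt_eqF.
have dl := is_derive1_comp (is_derive1_ln d0) (is_derive_poly det_poly u).
have dq := is_derive_qform_inv x d_neq0.
have dlq := is_deriveD dl dq.
have := is_derive1_comp (is_derive_expR _) (is_deriveZ (- 2^-1) dlq).
move=> /(is_deriveZ (2 * (Num.sqrt ((2 * pi) ^+ p))^-1)).
have scE (a b : R) : a *: b = a * b by [].
set F := (X in is_derive _ _ X _ -> _).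
have FE : F = fun v => 2 * path_pdf x v.
  apply/funext => v; rewrite /path_pdf mulrA /F [LHS]scE; congr (_ * expR _).
  by rewrite [LHS]scE !mulNr mulrC.
rewrite FE => /is_derive_eq; apply.
rewrite !scE (_ : expR _ = expR (- (ln det_poly.[u] +
  (quad_poly adj_poly x).[u] / det_poly.[u]) / 2)); last first.
  by congr expR; rewrite [LHS]scE !mulNr mulrC.
rewrite /score /path_pdf horner_exp; field.
rewrite d_neq0 andbT gt_eqF// sqrtr_gt0 exprn_gt0// mulr_gt0//.
exact: pi_gt0.
Qed.

Lemma continuous_ratio (P Q : {poly R}) u : Q.[u] != 0 ->
  {for u, continuous (fun v => P.[v] / Q.[v])}.
Proof.
move=> Q0; apply: cvgM; first exact: continuous_horner.
by apply: cvgV => //; exact: continuous_horner.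
Qed.

Lemma continuous_path_pdf x u : 0 < det_poly.[u] ->
  {for u, continuous (path_pdf x)}.
Proof.
move=> d0; apply: cvgM; first exact: cvg_cst.
apply: continuous_cvg; first exact: continuous_expR.
apply: cvgM; last exact: cvg_cst.
apply: cvgN; apply: cvgD; last by apply: continuous_ratio; rewrite gt_eqF.
apply: continuous_cvg; first exact: continuous_ln.
exact: continuous_horner.
Qed.

Lemma continuous_score x u : 0 < det_poly.[u] -> {for u, continuous (score x)}.
Proof.
move=> d0; apply: cvgB; apply: continuous_ratio; last by rewrite gt_eqF.
by rewrite horner_exp expf_neq0 ?gt_eqF.
Qed.

Lemma integral_score x :
  (\int[@lebesgue_measure R]_(u in `[0%R, 1%R]) (score x u * path_pdf x u)%:E =
   (2 * (gauss_pdf S1 x - gauss_pdf S0 x))%:E)%E.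
Proof.
have d0 u : u \in `[0, 1] -> 0 < det_poly.[u].
  by rewrite in_itv/= => u01; exact: det_poly_gt0.
have c01 u : u \in `[0, 1] -> {for u, continuous (fun v => 2 * path_pdf x v)}.
  move=> u01; apply: cvgM; first exact: cvg_cst.
  exact: continuous_path_pdf (d0 _ u01).
have V0 : V 0 = S0 by rewrite /Sigma subr0 scale1r scale0r addr0.
have V1 : V 1 = S1 by rewrite /Sigma subrr scale1r scale0r add0r.
have i0 : 0 \in `[0 : R, 1] by rewrite in_itv/= lexx ler01.
have i1 : 1 \in `[0 : R, 1] by rewrite in_itv/= lexx ler01.
rewrite (@continuous_FTC2 _ _ (fun v => 2 * path_pdf x v)) ?ltr01//.
- rewrite -EFinB -mulrBr -!path_pdfE ?V0 ?V1//; exact: d0.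
- apply: continuous_in_subspaceT => u; rewrite inE/= => u01.
  apply: cvgM; first exact: continuous_score (d0 _ u01).
  exact: continuous_path_pdf (d0 _ u01).
- split.
  + move=> u u01; have /d0 du : u \in `[0, 1] by exact: subset_itv_oo_cc.
    by have [] := is_derive_path_pdf x du.
  + by apply: cvg_at_right_filter; exact: c01.
  + by apply: cvg_at_left_filter; exact: c01.
- move=> u u01; have /d0 du : u \in `[0, 1] by exact: subset_itv_oo_cc.
  by rewrite derive1E; have [_ ->] := is_derive_path_pdf x du.
Qed.

End polynomial_path.

(** * Integration over the segment *)

Section unit_interval.
Context {R : realType}.
Local Notation I01 := (`[0%R, 1%R]%classic : set R).

(** Cutting off outside [0, 1], where V_u need not be invertible, gives
    functions that are measurable and bounded on the whole line. *)
Definition tame01 (h : R -> R) :=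
  measurable_fun setT (h \_ I01) /\ exists C, forall u, `|(h \_ I01) u| <= C.

Lemma tame01_ratio (h : R -> R) (P Q : {poly R}) :
  (forall u, 0 <= u <= 1 -> Q.[u] != 0) ->
  (forall u, 0 <= u <= 1 -> h u = P.[u] / Q.[u]) -> tame01 h.
Proof.
move=> Q0 hE; pose g u := P.[u] / Q.[u].
have gE : h \_ I01 = g \_ I01.
  apply/funext => u; rewrite !patchE; case: ifPn => //.
  by rewrite inE/= in_itv/= => /hE.
have cg : {within I01, continuous g}.
  apply: continuous_in_subspaceT => u; rewrite inE/= in_itv/= => u01.
  exact/continuous_ratio/Q0.
split; rewrite gE.
  apply/(measurable_restrictT _ _).1 => //.
  exact: subspace_continuous_measurable_fun.
have [c _ cmax] := EVT_max ler01 cg.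
have [e _ emin] := EVT_min ler01 cg.
exists (Num.max `|g c| `|g e|) => u; rewrite patchE; case: ifPn => [|_].
  rewrite inE/= => u01; have := cmax _ u01; have := emin _ u01 => gu1 gu2.
  rewrite le_max; have [g0|/ltW g0] := leP 0 (g u).
    by rewrite (ger0_norm g0) ger0_norm ?gu2// (le_trans g0).
  by rewrite (ler0_norm g0) (@ler0_norm _ (g e)) ?lerN2 ?gu1 ?orbT// (le_trans gu1).
by rewrite normr0 le_max normr_ge0.
Qed.

Context {p : nat}.

(** The cut-off entry by entry; the zero matrix outside [0, 1]. *)
Definition restrict01 (F : R -> 'M[R]_p) (u : R) : 'M[R]_p :=
  \matrix_(i, j) ((fun v => F v i j) \_ I01) u.

Lemma restrict01_in F u : 0 <= u <= 1 -> restrict01 F u = F u.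
Proof.
by move=> u01; apply/matrixP => i j; rewrite mxE patchE mem_set//= in_itv.
Qed.

Lemma restrict01_out F u : ~~ (0 <= u <= 1) -> restrict01 F u = 0.
Proof.
move=> u01; apply/matrixP => i j; rewrite !mxE patchE memNset//=.
by rewrite in_itv; exact/negP.
Qed.

Lemma measurable_qform_family (F : R -> 'M[R]_p) :
  (forall i j, measurable_fun setT (fun u => F u i j)) ->
  measurable_fun setT (fun z : p.-tuple R * R => qform (F z.2) z.1).
Proof.
move=> mF.
rewrite (_ : (fun z : p.-tuple R * R => qform (F z.2) z.1) = fun z =>
    \sum_i \sum_j F z.2 i j * (tnth z.1 i * tnth z.1 j)); last first.
  by apply/funext => z; exact: qformE.
apply: measurable_sum => i; apply: measurable_sum => j.
apply: measurable_funM.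
  exact: (measurableT_comp (mF i j) measurable_snd).
have mx k : measurable_fun setT (fun z : p.-tuple R * R => tnth z.1 k).
  exact: (measurableT_comp (measurable_tnth k) measurable_fst).
exact: measurable_funM.
Qed.

Lemma measurable_qform_restrict01 (F : R -> 'M[R]_p) :
  (forall i j, tame01 (fun u => F u i j)) ->
  measurable_fun setT (fun z : p.-tuple R * R => qform (restrict01 F z.2) z.1).
Proof.
move=> tF; apply: measurable_qform_family => i j.
rewrite (_ : (fun u => _) = (fun v => F v i j) \_ I01); first by have [] := tF i j.
by apply/funext => u; rewrite mxE.
Qed.

Lemma restrict01_bounded (F : R -> 'M[R]_p) :
  (forall i j, tame01 (fun u => F u i j)) ->
  exists C, forall u, \sum_i \sum_j `|restrict01 F u i j| <= C.
Proof.
move=> tF; have /choice[C CE] : forall ij : 'I_p * 'I_p, exists C, forall u,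
    `|restrict01 F u ij.1 ij.2| <= C.
  move=> [i j]; have [_ [C hC]] := tF i j.
  by exists C => u; rewrite mxE; exact: hC.
exists (\sum_i \sum_j C (i, j)) => u.
by apply: ler_sum => i _; apply: ler_sum => j _; exact: (CE (i, j)).
Qed.

End unit_interval.

Section product_integrability.
Context d (T : measurableType d) (R : realType).
Variable mu : {sigma_finite_measure set T -> \bar R}.
Local Notation la := (@lebesgue_measure R).

Lemma integrable_prod01 (w : T -> R) (k : T * R -> R) (C : R) :
  mu.-integrable setT (EFin \o w) -> measurable_fun setT k ->
  (forall x u, `|k (x, u)| <= C * `|w x|) ->
  (forall x u, ~~ (0 <= u <= 1) -> k (x, u) = 0) ->
  (mu \x la)%E.-integrable setT (EFin \o k).
Proof.
move=> iw mk kC k0.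
apply/(@integrable12ltyP _ _ _ _ R mu la); first exact/measurable_EFinP.
have iCw : mu.-integrable setT (fun x => C%:E * (w x)%:E)%E by exact: integrableZl.
have [_] := integrableP _ _ _ iCw; apply: le_lt_trans.
apply: ge0_le_integral => //.
- by move=> x _; exact: integral_ge0.
- apply: (measurable_fun_fubini_tonelli_F (m2 := la) (abse \o (EFin \o k))) => //.
    apply: measurableT_comp => //; exact/measurable_EFinP.
  by move=> z; exact: abse_ge0.
- apply: measurableT_comp => //; exact: measurable_int iCw.
move=> x _ /=.
have Cw0 : 0 <= C * `|w x| by rewrite (le_trans _ (kC x 0)).
apply: (@le_trans _ _ (\int[la]_(u in `[0%R, 1%R]) (C * `|w x|)%:E)%E).
  rewrite [leRHS]integral_mkcond; apply: ge0_le_integral => //.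
  - apply/measurable_EFinP; apply: measurableT_comp => //.
    exact: (measurableT_comp mk (pair1_measurable x)).
  - exact/(measurable_restrictT _ _).1.
  - move=> u _; rewrite patchE; case: ifPn => [_|].
      by rewrite lee_fin.
    rewrite notin_setE/= in_itv/= => /negP u01.
    by rewrite k0// normr0.
rewrite integral_cst//= lebesgue_measure_itv/= lte_fin ltr01 oppr0 adde0 mule1.
by rewrite lee_fin normrM ler_wpM2r// ler_norm.
Qed.

End product_integrability.

Section path_kernels.
Context {R : realType} {p : nat} (S0 S1 : 'M[R]_p) (t : R).
Hypotheses (S0_pd : posdefmx S0) (S1_pd : posdefmx S1) (t_gt0 : 0 < t).
Hypothesis phi_int : (@lebesgue_tuple R p).-integrable setT
  (EFin \o @gauss_pdf R p 1%:M).
Local Notation I01 := (`[0%R, 1%R]%classic : set R).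
Local Notation V := (Sigma S0 S1).
Local Notation mu := (@lebesgue_tuple R p).
Local Notation la := (@lebesgue_measure R).
Local Notation L := (dlogdetSigma S0 S1).

Definition dinvSigma u : 'M[R]_p := invmx (V u) *m (S1 - S0) *m invmx (V u).

Let d_neq0 u : 0 <= u <= 1 -> (det_poly S0 S1).[u] != 0.
Proof. by move=> u01; rewrite gt_eqF// det_poly_gt0. Qed.

Lemma tame01_invSigma i j : tame01 (fun u => invmx (V u) i j).
Proof.
apply: (@tame01_ratio _ _ (adj_poly S0 S1 i j) (det_poly S0 S1)) => // u u01.
by rewrite invmx_SigmaE ?d_neq0// !mxE mulrC.
Qed.

Lemma tame01_dinvSigma i j : tame01 (fun u => dinvSigma u i j).
Proof.
apply: (@tame01_ratio _ _ (dinv_poly S0 S1 i j) (det_poly S0 S1 ^+ 2)) => u u01.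
  by rewrite horner_exp expf_neq0 ?d_neq0.
rewrite /dinvSigma invmx_SigmaE ?d_neq0// -!scalemxAr -!scalemxAl scalerA.
rewrite -(ev_polyC u (S1 - S0)) -!map_mxM -/(dinv_poly S0 S1) mxE mxE.
by rewrite horner_exp -invfM expr2 mulrC.
Qed.

Lemma tame01_dlogSigma i j : tame01 (fun u => dlogSigma S0 S1 u i j).
Proof.
apply: (@tame01_ratio _ _
  ((map_mx polyC (S1 - S0) *m adj_poly S0 S1) i j) (det_poly S0 S1)) => // u u01.
rewrite /dlogSigma invmx_SigmaE ?d_neq0// -scalemxAr.
by rewrite [LHS]mxE -{1}(ev_polyC u (S1 - S0)) -map_mxM mxE mulrC.
Qed.

Lemma tame01_dlogdetSigma : tame01 L.
Proof.
apply: (@tame01_ratio _ _ (det_poly S0 S1)^`() (det_poly S0 S1)) => // u u01.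
by rewrite dlogdetSigmaE// det_poly_gt0.
Qed.

Lemma tame01_detVSigma : tame01 (fun u => (\det (V u))^-1).
Proof.
apply: (@tame01_ratio _ _ 1 (det_poly S0 S1)) => // u u01.
by rewrite hornerC mul1r det_polyE.
Qed.

(** Joint function of (x, u) equal to f_(V_u)(x) for u in [0, 1]. The constant
    and the determinant appear inverted under the root because only the
    inverse of the determinant is cut off. *)
Definition pdf_kernel (z : p.-tuple R * R) : R :=
  Num.sqrt (((2 * pi) ^+ p)^-1 * ((fun u => (\det (V u))^-1) \_ I01) z.2) *
  expR (- qform (restrict01 (fun u => invmx (V u)) z.2) z.1 / 2).

Lemma pdf_kernelE x u : 0 <= u <= 1 -> pdf_kernel (x, u) = gauss_pdf (V u) x.
Proof.
move=> u01; rewrite /pdf_kernel/= restrict01_in// patchE mem_set/= ?in_itv//.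
rewrite -invfM sqrtrV// mulr_ge0//.
  by rewrite exprn_ge0// mulr_ge0//; exact: pi_ge0.
exact/ltW/posdefmx_det_gt0/posdefmx_Sigma.
Qed.

(** The integrand obtained by differentiation, on the ball ([ball_kernel]), and
    the integrand of the theorem, on the ellipsoid ([ellipsoid_kernel]); the
    Gaussian weight of the latter is left out because it comes from the law of
    y. Both vanish for u outside [0, 1]. *)
Definition ball_kernel (z : p.-tuple R * R) : R :=
  (qform (restrict01 dinvSigma z.2) z.1 - (L \_ I01) z.2) *
  (qform 1%:M z.1 < t)%R%:R * pdf_kernel z.

Definition ellipsoid_kernel (z : p.-tuple R * R) : R :=
  (qform (restrict01 (dlogSigma S0 S1) z.2) z.1 - (L \_ I01) z.2) *
  (qform (V z.2) z.1 < t)%R%:R.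

Lemma ball_kernelE x u : 0 <= u <= 1 -> ball_kernel (x, u) =
  (qform (dinvSigma u) x - L u) * (qform 1%:M x < t)%R%:R * gauss_pdf (V u) x.
Proof.
move=> u01; rewrite /ball_kernel pdf_kernelE//= restrict01_in// patchE.
by rewrite mem_set//= in_itv.
Qed.

Lemma ellipsoid_kernelE x u : 0 <= u <= 1 -> ellipsoid_kernel (x, u) =
  (qform (dlogSigma S0 S1 u) x - L u) * (qform (V u) x < t)%R%:R.
Proof.
move=> u01; rewrite /ellipsoid_kernel/= restrict01_in// patchE.
by rewrite mem_set//= in_itv.
Qed.

Lemma ball_kernel_out x u : ~~ (0 <= u <= 1) -> ball_kernel (x, u) = 0.
Proof.
move=> u01; rewrite /ball_kernel/= restrict01_out// qform0 patchE.
by rewrite memNset/= ?in_itv ?subrr ?mul0r//; exact/negP.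
Qed.

Lemma ellipsoid_kernel_out x u : ~~ (0 <= u <= 1) -> ellipsoid_kernel (x, u) = 0.
Proof.
move=> u01; rewrite /ellipsoid_kernel/= restrict01_out// qform0 patchE.
by rewrite memNset/= ?in_itv ?subrr ?mul0r//; exact/negP.
Qed.

Let measurable_L : measurable_fun setT (fun z : p.-tuple R * R => (L \_ I01) z.2).
Proof. exact: measurableT_comp tame01_dlogdetSigma.1 measurable_snd. Qed.

Lemma measurable_pdf_kernel : measurable_fun setT pdf_kernel.
Proof.
apply: measurable_funM.
  have msqrt : measurable_fun setT (@Num.sqrt R).
    by apply: continuous_measurable_fun; exact: sqrt_continuous.
  apply: (measurableT_comp msqrt).
  apply: measurable_funM => //.
  exact: (measurableT_comp tame01_detVSigma.1 measurable_snd).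
apply: measurableT_comp => //; apply: measurable_funM => //.
apply: measurableT_comp => //; apply: measurable_qform_restrict01.
exact: tame01_invSigma.
Qed.

Lemma measurable_ball_kernel : measurable_fun setT ball_kernel.
Proof.
apply: measurable_funM; last exact: measurable_pdf_kernel.
apply: measurable_funM.
  apply: measurable_funB => //; apply: measurable_qform_restrict01.
  exact: tame01_dinvSigma.
exact: (measurableT_comp (measurable_qform_lt 1%:M t) measurable_fst).
Qed.

Lemma measurable_ellipsoid_kernel : measurable_fun setT ellipsoid_kernel.
Proof.
apply: measurable_funM.
  apply: measurable_funB => //; apply: measurable_qform_restrict01.
  exact: tame01_dlogSigma.
apply: measurableT_comp => //; apply: measurable_fun_ltr => //.
apply: measurable_qform_family => i j.
rewrite (_ : (fun u => V u i j) = fun u => (1 - u) * S0 i j + u * S1 i j); last first.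
  by apply/funext => u; rewrite !mxE.
by apply: measurable_funD; apply: measurable_funM => //; exact: measurable_funB.
Qed.

Lemma pdf_kernel_bounded : exists C, forall x u, 0 <= u <= 1 ->
  `|pdf_kernel (x, u)| <= C.
Proof.
have [_ [C hC]] := tame01_detVSigma.
exists (Num.sqrt (((2 * pi) ^+ p)^-1 * C)) => x u u01.
rewrite /pdf_kernel/= normrM ger0_norm ?sqrtr_ge0// -[leRHS]mulr1.
have pi0 : 0 <= ((2 * pi) ^+ p)^-1 :> R.
  by rewrite invr_ge0 exprn_ge0// mulr_ge0//; exact: pi_ge0.
apply: ler_pM => //; rewrite ?sqrtr_ge0//.
  rewrite ler_wsqrtr// ler_wpM2l// (le_trans _ (hC u))//; exact: ler_norm.
rewrite ger0_norm ?expR_ge0// -[leRHS]expR0 ler_expR mulNr oppr_le0 restrict01_in//.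
by rewrite mulr_ge0// posdefmx_ge0//; exact/posdefmx_inv/posdefmx_Sigma.
Qed.

(** The standard Gaussian density is bounded below on the ball. *)
Lemma integrable_ball :
  mu.-integrable setT (fun x => ((qform 1%:M x < t)%R%:R : R)%:E).
Proof.
pose C := Num.sqrt ((2 * pi) ^+ p) * expR (t / 2) : R.
apply: (@le_integrable _ _ _ _ _ _ _ (fun x => C%:E * (gauss_pdf 1%:M x)%:E)%E) => //.
- by apply/measurable_EFinP; exact: measurable_qform_lt.
- move=> x _; rewrite -EFinM !abse_EFin lee_fin.
  have [xt|xt] := ltP (qform 1%:M x) t; last by rewrite normr0.
  rewrite normr1 ger0_norm; last first.
    by rewrite mulr_ge0 ?gauss_pdf_ge0// mulr_ge0 ?sqrtr_ge0 ?expR_ge0.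
  rewrite /C /gauss_pdf det1 mulr1 mulrACA divff ?mul1r; last first.
    rewrite gt_eqF// sqrtr_gt0 exprn_gt0// mulr_gt0//; exact: pi_gt0.
  rewrite -expRD -[leLHS]expR0 ler_expR invmx1 -mulrDl mulr_ge0// subr_ge0.
  exact: ltW.
- exact: integrableZl.
Qed.

Let form_bounded (F : R -> 'M[R]_p) (S : R -> 'M[R]_p) M :
  (forall i j, tame01 (fun u => F u i j)) ->
  (forall u, 0 <= u <= 1 -> posdefmx (S u)) ->
  (forall u, 0 <= u <= 1 -> \tr (invmx (S u)) <= M) ->
  exists C, forall x u, 0 <= u <= 1 ->
    `|(qform (restrict01 F u) x - (L \_ I01) u) * (qform (S u) x < t)%R%:R| <= C.
Proof.
move=> tF Spd SM; have [C hC] := restrict01_bounded tF.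
have [_ [D hD]] := tame01_dlogdetSigma.
exists (C * (M * t) + D) => x u u01; rewrite mulrBl (le_trans (ler_normB _ _))//.
apply: lerD; last first.
  by rewrite normrM (le_trans _ (hD u))// ler_piMr// normr_nat lern1 leq_b1.
apply: (le_trans (qform_indic_le _ _ (Spd _ u01) t_gt0)).
have tr0 : 0 <= \tr (invmx (S u)).
  by apply: sumr_ge0 => i _; exact/ltW/posdefmx_diag_gt0/posdefmx_inv/Spd.
apply: ler_pM => //.
- by apply: sumr_ge0 => i _; apply: sumr_ge0.
- by rewrite mulr_ge0// ltW.
- by rewrite ler_wpM2r ?SM// ltW.
Qed.

Lemma integrable_ball_kernel : (mu \x la)%E.-integrable setT (EFin \o ball_kernel).
Proof.
have [C hC] := @form_bounded dinvSigma (fun=> 1%:M) (\tr (invmx 1%:M))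
  tame01_dinvSigma (fun _ _ => posdefmx1) (fun _ _ => lexx _).
have [D hD] := pdf_kernel_bounded.
apply: (@integrable_prod01 _ _ _ _ (fun x => (qform 1%:M x < t)%R%:R) _ (C * D)).
- exact: integrable_ball.
- exact: measurable_ball_kernel.
- move=> x u; have [u01|u01] := boolP (0 <= u <= 1); last first.
    rewrite ball_kernel_out// normr0 mulr_ge0//.
    have i0 : 0 <= (0 : R) <= 1 by rewrite lexx ler01.
    by rewrite mulr_ge0// (le_trans _ (hC x _ i0), le_trans _ (hD x _ i0)).
  rewrite /ball_kernel normrM/=.
  have [xt|xt] := ltP (qform 1%:M x) t; last by rewrite mulr0 normr0 mul0r mulr0.
  rewrite normr1 !mulr1; apply: ler_pM => //; last exact: hD.
  by have := hC x u u01; rewrite xt mulr1.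
- exact: ball_kernel_out.
Qed.

Lemma integrable_ellipsoid_kernel : (mu \x la)%E.-integrable setT
  (fun z => (ellipsoid_kernel z * gauss_pdf 1%:M z.1)%:E).
Proof.
have [M hM] := restrict01_bounded tame01_invSigma.
have [u u01|u u01|C hC] := @form_bounded (dlogSigma S0 S1) V M tame01_dlogSigma.
- exact: posdefmx_Sigma.
- rewrite (le_trans _ (hM u))// restrict01_in//; apply: ler_sum => i _.
  rewrite (bigD1 i)//= (le_trans (ler_norm _))// lerDl.
  by apply: sumr_ge0.
apply: (@integrable_prod01 _ _ _ _ (gauss_pdf 1%:M)
   (fun z => ellipsoid_kernel z * gauss_pdf 1%:M z.1) C).
- exact: phi_int.
- apply: measurable_funM; first exact: measurable_ellipsoid_kernel.
  exact: (measurableT_comp (measurable_gauss_pdf 1%:M) measurable_fst).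
- move=> x u; rewrite normrM ler_wpM2r//.
  have [u01|u01] := boolP (0 <= u <= 1); first exact: hC.
  rewrite ellipsoid_kernel_out// normr0.
  have i0 : 0 <= (0 : R) <= 1 by rewrite lexx ler01.
  by rewrite (le_trans _ (hC x _ i0)).
- by move=> x u u01; rewrite ellipsoid_kernel_out// mul0r.
Qed.

(** Integration in u at a fixed x: the fundamental theorem of calculus. *)
Lemma integral_ball_kernel_path x :
  (\int[la]_u (ball_kernel (x, u))%:E =
   ((qform 1%:M x < t)%R%:R * (2 * (gauss_pdf S1 x - gauss_pdf S0 x)))%:E)%E.
Proof.
transitivity (\int[la]_(u in I01) ((qform 1%:M x < t)%R%:R *
    (score S0 S1 x u * path_pdf S0 S1 x u))%:E)%E.
  rewrite [RHS]integral_mkcond; apply: eq_integral => u _; rewrite patchE.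
  case: ifPn => [|].
    rewrite inE/= in_itv/= => u01; have d0 := det_poly_gt0 S0_pd S1_pd u01.
    rewrite ball_kernelE// path_pdfE// /score horner_exp -qform_dinvE ?gt_eqF//.
    by rewrite -dlogdetSigmaE// (mulrC (_ - _)) mulrA.
  rewrite notin_setE/= in_itv/= => /negP u01.
  by rewrite ball_kernel_out.
case: (qform 1%:M x < t)%R; last first.
  by rewrite integral0_eq ?mul0r// => u _; rewrite mul0r.
by under eq_integral do rewrite mul1r; rewrite integral_score// mul1r.
Qed.

(** Integration in x at a fixed u: the symmetrization over the ellipsoid. *)
Lemma integral_ball_kernel_space u :
  (\int[mu]_x (ball_kernel (x, u))%:E =
   \int[mu]_x (ellipsoid_kernel (x, u) * gauss_pdf 1%:M x)%:E)%E.
Proof.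
have [u01|u01] := boolP (0 <= u <= 1); last first.
  by apply: eq_integral => x _; rewrite ball_kernel_out// ellipsoid_kernel_out// mul0r.
under eq_integral do rewrite ball_kernelE//.
under [RHS]eq_integral do rewrite ellipsoid_kernelE//.
exact: (integral_ball_ellipsoid (posdefmx_Sigma S0_pd S1_pd u01)).
Qed.

Lemma integral_kernels :
  (\int[mu]_x ((qform 1%:M x < t)%R%:R *
      (2 * (gauss_pdf S1 x - gauss_pdf S0 x)))%:E =
   \int[(mu \x la)%E]_z (ellipsoid_kernel z * gauss_pdf 1%:M z.1)%:E)%E.
Proof.
rewrite -(integral21_prod_meas1 integrable_ellipsoid_kernel).
transitivity (\int[mu]_x \int[la]_u (ball_kernel (x, u))%:E)%E.
  by apply: eq_integral => x _; rewrite integral_ball_kernel_path.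
rewrite (Fubini integrable_ball_kernel); apply: eq_integral => u _.
exact: integral_ball_kernel_space.
Qed.

End path_kernels.

(** * The law of the pair and the laws of the endpoints *)

Section joint_law.
Local Open Scope ereal_scope.
Context {R : realType} {p : nat} d (T : measurableType d) (Q : probability T R).
Variables (y : {RV Q >-> p.-tuple R}) (s : {RV Q >-> R}).
Hypotheses (y_law : has_gaussian_law y 1%:M) (s_law : has_uniform01_law s).
Hypothesis ys_indep : independent_RV y s.
Local Notation mu := (@lebesgue_tuple R p).
Local Notation la := (@lebesgue_measure R).

(** Lebesgue measure lives on [measurableTypeR R], which has the same measurable
    sets as [R] but is a different measurable type; [s] is retyped so that its
    law can be compared with Lebesgue measure. *)
Let measurable_sR : measurable_fun setT (s : T -> measurableTypeR R).
Proof. by have ms : measurable_fun setT s by []; move=> mT B mB; exact: ms. Qed.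

Let sR : {mfun T >-> measurableTypeR R} :=
  HB.pack (s : T -> measurableTypeR R)
    (isMeasurableFun.Build _ _ _ _ _ measurable_sR).

Let ys (w : T) : p.-tuple R * measurableTypeR R := (y w, s w).

Let measurable_ys : measurable_fun setT ys.
Proof. by apply/measurable_fun_pairP; split=> //; exact: measurable_sR. Qed.

(** Independence makes the joint law a product measure; Tonelli's theorem and
    the densities of the two factors do the rest. *)
Lemma joint_density (A : set (p.-tuple R * measurableTypeR R)) : measurable A ->
  Q (ys @^-1` A) =
  \int[mu \x la]_(z in A) (gauss_pdf 1%:M z.1 * uniform_pdf 0 1 z.2)%:E.
Proof.
move=> mA.
have [m mE] := pushforward_is_measure Q measurable_ys.
have -> : Q (ys @^-1` A) = (distribution Q y \x distribution Q sR) A.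
  have -> : Q (ys @^-1` A) = m A by rewrite mE.
  apply/esym/product_measure_unique => // B C mB mC.
  by rewrite mE; exact: ys_indep.
have m1A : measurable_fun setT (EFin \o (\1_A : p.-tuple R * measurableTypeR R -> R)).
  exact/measurable_EFinP/measurable_indic.
have mg : measurable_fun setT (fun z : p.-tuple R * measurableTypeR R =>
    (gauss_pdf 1%:M z.1 * uniform_pdf 0 1 z.2)%R).
  apply: measurable_funM.
    exact: (measurableT_comp (measurable_gauss_pdf 1%:M) measurable_fst).
  exact: (measurableT_comp (measurable_uniform_pdf 0 1) measurable_snd).
have mupd : measurable_fun [set: measurableTypeR R] (@uniform_pdf R 0 1).
  exact: measurable_uniform_pdf.
have upd0 u : (0 <= @uniform_pdf R 0 1 u)%R by exact: uniform_pdf_ge0.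
have s_density B : measurable B ->
    distribution Q sR B = \int[la]_(u in B) (uniform_pdf 0 1 u)%:E by exact: s_law.
have mF : measurable_fun setT (fun x => \int[distribution Q sR]_u (\1_A (x, u))%:E).
  by apply: (measurable_fun_fubini_tonelli_F (EFin \o \1_A)) => // z; rewrite lee_fin.
transitivity (\int[distribution Q y \x distribution Q sR]_z (\1_A z)%:E).
  by rewrite integral_indic// setIT.
have /= -> := fubini_tonelli1 (m1 := distribution Q y) (m2 := distribution Q sR)
  _ m1A (fun z => _).
rewrite (ge0_integral_density (measurable_gauss_pdf 1%:M) (gauss_pdf_ge0 1%:M) y_law) //.
- rewrite [RHS]integral_mkcond; set k := _ \_ A.
  have kE z : k z = (\1_A z * (gauss_pdf 1%:M z.1 * uniform_pdf 0 1 z.2))%:E.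
    by rewrite /k patchE indicE; case: ifPn => _; rewrite ?mul1r ?mul0r.
  have mk : measurable_fun setT k.
    by apply/(measurable_restrictT _ _).1 => //; exact/measurable_funTS/measurable_EFinP.
  have k0 z : 0 <= k z by rewrite kE lee_fin !mulr_ge0// gauss_pdf_ge0.
  have /= -> := @fubini_tonelli1 _ _ _ _ R mu la k mk k0.
  apply: eq_integral => x _.
  rewrite /fubini_F.
  have mx : measurable_fun setT (fun u => (\1_A (x, u))%:E : \bar R).
    exact: (measurableT_comp m1A (pair1_measurable x)).
  rewrite (ge0_integral_density mupd upd0 s_density mx); last first.
    by move=> u; rewrite lee_fin.
  rewrite -ge0_integralZr//.
  + apply: eq_integral => u _; rewrite kE -!EFinM; congr EFin => /=.
    by rewrite mulrAC [RHS]mulrA.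
  + apply: emeasurable_funM => //; apply/measurable_EFinP.
    exact: measurable_uniform_pdf.
  + by move=> u _; rewrite -EFinM lee_fin mulr_ge0.
  + by rewrite lee_fin gauss_pdf_ge0.
- by move=> x; apply: integral_ge0 => u _; rewrite lee_fin.
- by move=> z; rewrite lee_fin.
Qed.

Lemma integral_joint (K : p.-tuple R * R -> R) : measurable_fun setT K ->
  \int[Q]_w (K (ys w))%:E =
  \int[mu \x la]_z (K z * (gauss_pdf 1%:M z.1 * uniform_pdf 0 1 z.2))%:E.
Proof.
move=> mK; have [m mE] := pushforward_is_measure Q measurable_ys.
rewrite -(integral_image (nu := m) measurable_ys (f := EFin \o K)); last 2 first.
- by move=> A mA; rewrite mE.
- exact/measurable_EFinP.
apply: integral_density => //.
- apply: measurable_funM.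
    exact: (measurableT_comp (measurable_gauss_pdf 1%:M) measurable_fst).
  exact: (measurableT_comp (measurable_uniform_pdf 0 1) measurable_snd).
- by move=> z; rewrite mulr_ge0 ?gauss_pdf_ge0 ?uniform_pdf_ge0.
- by move=> A mA; rewrite mE; exact: joint_density.
Qed.

Lemma uniform01_out : Q (s @^-1` (~` `[0%R, 1%R]%classic)) = 0.
Proof.
have -> : Q (s @^-1` (~` `[0%R, 1%R]%classic)) =
    uniform_prob (@ltr01 R) (~` `[0%R, 1%R]%classic).
  by apply: s_law; exact: measurableC.
by rewrite /uniform_prob integral_uniform_pdf setICl integral_set0.
Qed.

End joint_law.

Lemma gaussian_law_integrable (R : realType) p (S : 'M[R]_p) d
    (T : measurableType d) (P : probability T R) (x : {RV P >-> p.-tuple R}) :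
  has_gaussian_law x S ->
  (@lebesgue_tuple R p).-integrable setT (EFin \o gauss_pdf S).
Proof.
move=> x_law; apply/integrableP; split.
  by apply/measurable_EFinP; exact: measurable_gauss_pdf.
under eq_integral do rewrite gee0_abs ?lee_fin ?gauss_pdf_ge0//.
by rewrite -x_law// probability_setT ltry.
Qed.

Lemma gaussian_law_ball (R : realType) p (S : 'M[R]_p) d
    (T : measurableType d) (P : probability T R) (x : {RV P >-> p.-tuple R}) t :
  has_gaussian_law x S -> 0 < t ->
  P (x @^-1` eball t) =
  (\int[@lebesgue_tuple R p]_z ((qform 1%:M z < t)%R%:R * gauss_pdf S z)%:E)%E.
Proof.
move=> x_law t0; have mB : measurable (eball t : set (p.-tuple R)).
  rewrite eballE// (_ : [set x | _] = qform 1%:M @^-1` `]-oo, t[%classic).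
    by rewrite -[X in measurable X]setTI; exact: (measurable_qform 1%:M).
  by apply/seteqP; split => z /=; rewrite in_itv.
have -> : P (x @^-1` eball t) = distribution P x (eball t) by [].
rewrite x_law// integral_mkcond; apply: eq_integral => z _; rewrite patchE eballE//.
case: ifPn => [|].
  by rewrite inE/= => ->; rewrite mul1r.
by rewrite notin_setE/= => /negP/negbTE ->; rewrite mul0r.
Qed.

Theorem corollary3p4 (R : realType) (p : nat) (p_ge1 : (1 <= p)%N)
  (S0 S1 : 'M[R]_p) (S0_pd : posdefmx S0) (S1_pd : posdefmx S1)
  (d : measure_display) (T : measurableType d) (P : probability T R)
  (x0 x1 : {RV P >-> p.-tuple R})
  (x0_law : has_gaussian_law x0 S0) (x1_law : has_gaussian_law x1 S1)
  (x0x1_indep : independent_RV x0 x1)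
  (d' : measure_display) (T' : measurableType d') (Q : probability T' R)
  (y : {RV Q >-> p.-tuple R}) (s : {RV Q >-> R})
  (y_law : has_gaussian_law y 1%:M) (s_law : has_uniform01_law s)
  (ys_indep : independent_RV y s)
  (t : R) (t_gt0 : 0 < t) :
  (P (x1 @^-1` eball t) - P (x0 @^-1` eball t))%E =
  Lop y s S0 S1 (fun z u => (qform (Sigma S0 S1 u) z < t)%R%:R).
Proof.
have phi_int := gaussian_law_integrable y_law.
have LopE : ('E_Q[fun w => ((qform (dlogSigma S0 S1 (s w)) (y w)
    - dlogdetSigma S0 S1 (s w)) * (qform (Sigma S0 S1 (s w)) (y w) < t)%R%:R)%R] =
  \int[@lebesgue_tuple R p]_x ((qform 1%:M x < t)%R%:R *
      (2 * (gauss_pdf S1 x - gauss_pdf S0 x)))%:E)%E.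
  rewrite (integral_kernels S0_pd S1_pd t_gt0 phi_int) unlock.
  transitivity (\int[Q]_w (ellipsoid_kernel S0 S1 t (y w, s w))%:E)%E.
    apply: (integral_off_null _ (uniform01_out s_law)).
      rewrite -[X in measurable X]setTI.
      by apply: (measurable_funP s) => //; exact: measurableC.
    move=> w /= /contrapT; rewrite in_itv/= => s01.
    by rewrite ellipsoid_kernelE.
  rewrite (integral_joint y_law s_law ys_indep); last exact: measurable_ellipsoid_kernel.
  apply: eq_integral => -[x u] _ /=; rewrite /uniform_pdf.
  case: ifPn => [_|u01]; first by rewrite subr0 invr1 mulr1.
  by rewrite ellipsoid_kernel_out// !mul0r.
rewrite /Lop LopE (gaussian_law_ball x0_law t_gt0) (gaussian_law_ball x1_law t_gt0).
have ball_int S (x : {RV P >-> p.-tuple R}) : has_gaussian_law x S ->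
    (@lebesgue_tuple R p).-integrable setT
      (fun z => ((qform 1%:M z < t)%R%:R * gauss_pdf S z)%:E).
  move=> /gaussian_law_integrable; apply: le_integrable => //.
    apply/measurable_EFinP; apply: measurable_funM; first exact: measurable_qform_lt.
    exact: measurable_gauss_pdf.
  move=> z _; rewrite !abse_EFin lee_fin normrM ler_piMl//.
  by rewrite normr_nat lern1 leq_b1.
have int0 := ball_int _ _ x0_law; have int1 := ball_int _ _ x1_law.
rewrite -integralB//.
under [X in (_ = _ * X)%E]eq_integral => x _.
  rewrite (_ : (_ * _)%:E = 2%:E * (((qform 1%:M x < t)%R%:R * gauss_pdf S1 x)%:E -
    ((qform 1%:M x < t)%R%:R * gauss_pdf S0 x)%:E))%E; last first.
    by rewrite -EFinB -EFinM; congr EFin; rewrite -mulrBr mulrCA.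
  over.
rewrite integralZl//; last exact: integrableB.
by rewrite muleA -EFinM mulVf// mul1e.
Qed.
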